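(* In the chain of inclusions $$[\rho_1(\Gamma),\rho_1(\Gamma)]\lhd\rho_1(\Gamma)\subset\mathbf{PU}(2,1;\mathcal{O}_3),$$ both inclusions are of infinite index; that is, $[\rho_1(\Gamma),\rho_1(\Gamma)]$ has infinite index in $\rho_1(\Gamma)$, and $\rho_1(\Gamma)$ has infinite index in $\mathbf{PU}(2,1;\mathcal{O}_3)$.
   Context: Commutators are $[x,y]=xyx^{-1}y^{-1}$, and $[G,G]$ is the commutator subgroup of a group $G$. $\Gamma=\langle g_1,g_3\mid [g_3,g_1^{-1}]g_3=g_1[g_3,g_1^{-1}]\rangle$ is the fundamental group of the figure eight knot complement. $\mathbf{U}(2,1)$ is the group of complex $3\times3$ matrices preserving the Hermitian form $\langle Z,W\rangle=Z_1\overline{W}_3+Z_2\overline{W}_2+Z_3\overline{W}_1$, and $\mathbf{PU}(2,1)$ is its image in $PGL_3(\mathbb{C})$. $\mathcal{O}_3=\mathbb{Z}[\omega_3]$ with $\omega_3=-\frac12+i\frac{\sqrt3}{2}$ is the ring of integers of $\mathbb{Q}(i\sqrt3)$, and $\mathbf{PU}(2,1;\mathcal{O}_3)$ is the subgroup of $\mathbf{PU}(2,1)$ of elements represented by matrices of $\mathbf{U}(2,1)$ with entries in $\mathcal{O}_3$ (an Eisenstein–Picard modular group). The representation $\rho_1:\Gamma\to\mathbf{PU}(2,1)$ is given by (the projective classes of) $$\rho_1(g_1)=\begin{pmatrix}1&1&-\frac12-\frac{\sqrt3}{2}i\\0&1&-1\\0&0&1\end{pmatrix},\qquad \rho_1(g_3)=\begin{pmatrix}1&0&0\\1&1&0\\-\frac12-\frac{\sqrt3}{2}i&-1&1\end{pmatrix};$$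 its image lies in $\mathbf{PU}(2,1;\mathcal{O}_3)$. *)

(* Defs.v *)
From HB Require Import structures.
From mathcomp Require Import all_boot all_order all_algebra.
From mathcomp Require Import generic_quotient.
From mathcomp Require Import ring.
From mathcomp Require Import boolp classical_sets cardinality reals.
From mathcomp Require Import complex.

Set Implicit Arguments.
Unset Strict Implicit.
Unset Printing Implicit Defensive.

Import Order.TTheory GRing.Theory Num.Theory.

Local Open Scope classical_set_scope.
Local Open Scope quotient_scope.
Local Open Scope group_scope.

Section Subgroups.
Variable G : groupType.
Implicit Types (x y : G) (H K : set G).

Definition subgroup_set H : Prop :=
  [/\ H 1, forall x y, H x -> H y -> H (x * y) & forall x, H x -> H x^-1].

(* The library's [~ x, y] is x^-1 * y^-1 * x * y; this is the other one. *)
Definition grp_comm x y : G := x * y * x^-1 * y^-1.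

Definition derived_subgroup K : set G :=
  smallest subgroup_set [set grp_comm x y | x in K & y in K].

Definition normal_subgroup H K : Prop :=
  [/\ subgroup_set H, H `<=` K &
      forall x y, K x -> H y -> H (x * y * x^-1)].

Definition left_coset x H : set G := [set x * y | y in H].

Definition infinite_index H K : Prop :=
  infinite_set [set left_coset x H | x in K].

End Subgroups.

(* A word in the letters i^{+1} = (i, false) and i^{-1} = (i, true). *)
Definition word (I : choiceType) : choiceType := seq (I * bool).

Section Words.
Variable I : choiceType.
Implicit Types u v w : word I.

Definition wgen (i : I) : word I := [:: (i, false)].
Definition winv w : word I := rev [seq (l.1, ~~ l.2) | l <- w].
Definition wcomm u v : word I := u ++ v ++ winv u ++ winv v.

Definition weval (H : groupType) (f : I -> H) w : H :=
  \prod_(l <- w) (if l.2 then (f l.1)^-1 else f l.1).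

Variable rels : seq (word I * word I).

(* The congruence on words whose quotient is the group with generators I and
   relations u = v for (u, v) in rels. *)
Inductive pres_eq : word I -> word I -> Prop :=
| pres_refl w : pres_eq w w
| pres_sym u v : pres_eq u v -> pres_eq v u
| pres_trans u v w : pres_eq u v -> pres_eq v w -> pres_eq u w
| pres_cat u u' v v' :
    pres_eq u u' -> pres_eq v v' -> pres_eq (u ++ v) (u' ++ v')
| pres_cancel i b : pres_eq [:: (i, b); (i, ~~ b)] [::]
| pres_rel u v : (u, v) \in rels -> pres_eq u v.

Definition pres_eqb : rel (word I) := fun u v => `[< pres_eq u v >].

Lemma pres_eqb_refl : reflexive pres_eqb.
Proof. by move=> w; apply/asboolP; exact: pres_refl. Qed.

Lemma pres_eqb_sym : symmetric pres_eqb.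
Proof. by move=> u v; apply/asboolP/asboolP; exact: pres_sym. Qed.

Lemma pres_eqb_trans : transitive pres_eqb.
Proof. by move=> v u w /asboolP uv /asboolP vw; apply/asboolP/(pres_trans uv). Qed.

Canonical pres_equiv := EquivRel pres_eqb pres_eqb_refl pres_eqb_sym
  pres_eqb_trans.

Definition presented := {eq_quot pres_equiv}%qT.
HB.instance Definition _ := Choice.on presented.
HB.instance Definition _ := EqQuotient.on presented.

Definition pres_class w : presented := \pi w.

Lemma pres_classP u v : pres_class u = pres_class v <-> pres_eq u v.
Proof.
by split=> [/eqmodP/asboolP|uv] //; apply/eqmodP/asboolP.
Qed.

Lemma pres_reprK (x : presented) : pres_class (repr x) = x.
Proof. exact: reprK. Qed.

Lemma pres_class_ind (P : presented -> Prop) :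
  (forall w, P (pres_class w)) -> forall x, P x.
Proof. by move=> h x; rewrite -(pres_reprK x). Qed.

Lemma winv_cat u v : winv (u ++ v) = winv v ++ winv u.
Proof. by rewrite /winv map_cat rev_cat. Qed.

Lemma winvK : involutive winv.
Proof.
move=> w; rewrite /winv map_rev revK -map_comp -[RHS]map_id.
by apply: eq_map => -[i b] /=; rewrite negbK.
Qed.

Lemma pres_eq_mulV w : pres_eq (w ++ winv w) [::].
Proof.
elim/last_ind: w => [|w [i b] IHw]; first exact: pres_refl.
rewrite -cats1 winv_cat -catA; apply: pres_trans IHw.
apply: pres_cat (pres_refl _) _; rewrite catA -[X in pres_eq _ X]cat0s.
by apply: pres_cat (pres_refl _); exact: pres_cancel.
Qed.

Lemma pres_eq_inv u v : pres_eq u v -> pres_eq (winv u) (winv v).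
Proof.
move=> uv; apply: (@pres_trans _ (winv u ++ (v ++ winv v))).
  rewrite -[X in pres_eq X _]cats0.
  apply: pres_cat (pres_refl _) _; exact/pres_sym/pres_eq_mulV.
rewrite catA -[X in pres_eq _ X]cat0s; apply: pres_cat (pres_refl _).
apply: (@pres_trans _ (winv u ++ u)).
  exact/(pres_cat (pres_refl _))/pres_sym.
by rewrite -{2}(winvK u); exact: pres_eq_mulV.
Qed.

Definition pres_one : presented := pres_class [::].
Definition pres_mul (x y : presented) : presented :=
  pres_class (repr x ++ repr y).
Definition pres_inv (x : presented) : presented := pres_class (winv (repr x)).

Lemma pres_mulE u v :
  pres_mul (pres_class u) (pres_class v) = pres_class (u ++ v).
Proof. by apply/pres_classP/pres_cat; apply/pres_classP/pres_reprK. Qed.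

Lemma pres_invE u : pres_inv (pres_class u) = pres_class (winv u).
Proof. by apply/pres_classP/pres_eq_inv/pres_classP/pres_reprK. Qed.

Lemma pres_mulA : associative pres_mul.
Proof.
elim/pres_class_ind=> u; elim/pres_class_ind=> v; elim/pres_class_ind=> w.
by rewrite !pres_mulE catA.
Qed.

Lemma pres_mul1g : left_id pres_one pres_mul.
Proof. by elim/pres_class_ind=> u; rewrite pres_mulE. Qed.

Lemma pres_mulg1 : right_id pres_one pres_mul.
Proof. by elim/pres_class_ind=> u; rewrite pres_mulE cats0. Qed.

Lemma pres_mulgV : right_inverse pres_one pres_inv pres_mul.
Proof.
elim/pres_class_ind=> u; rewrite pres_invE pres_mulE.
exact/pres_classP/pres_eq_mulV.
Qed.

Lemma pres_mulVg : left_inverse pres_one pres_inv pres_mul.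
Proof.
elim/pres_class_ind=> u; rewrite pres_invE pres_mulE.
by apply/pres_classP; rewrite -{2}(winvK u); exact: pres_eq_mulV.
Qed.

HB.instance Definition _ := isGroup.Build presented
  pres_mulA pres_mul1g pres_mulg1 pres_mulVg pres_mulgV.

Definition pres_gen (i : I) : presented := pres_class (wgen i).

Section Lift.
Variables (H : groupType) (f : I -> H).
Hypothesis f_rels : forall u v, (u, v) \in rels -> weval f u = weval f v.

Lemma weval_cat u v : weval f (u ++ v) = weval f u * weval f v.
Proof. by rewrite /weval big_cat. Qed.

Lemma weval_gen i : weval f (wgen i) = f i.
Proof. by rewrite /weval big_seq1. Qed.

Lemma weval_inv w : weval f (winv w) = (weval f w)^-1.
Proof.
elim: w => [|[i b] w IHw]; first by rewrite /weval /winv big_nil invg1.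
rewrite -cat1s winv_cat !weval_cat IHw invgM /weval !big_seq1 /=.
by case: b => /=; rewrite ?invgK.
Qed.

Lemma weval_grp_comm u v : weval f (wcomm u v) = grp_comm (weval f u) (weval f v).
Proof. by rewrite /wcomm /grp_comm !weval_cat !weval_inv !mulgA. Qed.

Lemma weval_pres_eq u v : pres_eq u v -> weval f u = weval f v.
Proof.
elim=> // [? ? ? _ -> //|? ? ? ? _ e1 _ e2|i b].
  by rewrite !weval_cat e1 e2.
rewrite /weval !big_cons big_nil /= mulg1.
by case: b => /=; rewrite ?mulgV ?mulVg.
Qed.

(* The homomorphism out of the presented group that sends pres_gen i to f i. *)
Definition pres_lift (_ : forall u v, (u, v) \in rels -> weval f u = weval f v)
  (x : presented) : H := weval f (repr x).

Lemma pres_liftE w : pres_lift f_rels (pres_class w) = weval f w.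
Proof. exact/weval_pres_eq/pres_classP/pres_reprK. Qed.

Lemma pres_lift_gen i : pres_lift f_rels (pres_gen i) = f i.
Proof. by rewrite pres_liftE weval_gen. Qed.

Lemma pres_lift_morphism : monoid.monoid_morphism (pres_lift f_rels).
Proof.
split; first by rewrite pres_liftE /weval big_nil.
elim/pres_class_ind=> u; elim/pres_class_ind=> v.
by rewrite [_ * _]pres_mulE !pres_liftE weval_cat.
Qed.

HB.instance Definition _ :=
  isUMagmaMorphism.Build presented H (pres_lift f_rels) pres_lift_morphism.

End Lift.
End Words.

(* Generators: true stands for g_1 and false for g_3. *)
Definition fig8_rels : seq (word bool * word bool) :=
  let w1 := wgen true in let w3 := wgen false in
  [:: (wcomm w3 (winv w1) ++ w3, w1 ++ wcomm w3 (winv w1))].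

Definition Gamma : groupType := presented fig8_rels.
Definition g1 : Gamma := pres_gen fig8_rels true.
Definition g3 : Gamma := pres_gen fig8_rels false.

Section ProjectiveLinear.
Variables (F : fieldType) (n : nat).

Record GL : Type := MkGL { GLmx :> 'M[F]_n; GL_unit : GLmx \in unitmx }.

HB.instance Definition _ := [isSub for GLmx].
HB.instance Definition _ := [Choice of GL by <:].

Implicit Types A B : GL.

Definition GL_one : GL := MkGL (unitmx1 F n).
Fact GL_mul_subproof A B : (A *m B)%R \in unitmx.
Proof. by rewrite unitmx_mul !GL_unit. Qed.
Definition GL_mul A B : GL := MkGL (GL_mul_subproof A B).
Fact GL_inv_subproof A : invmx A \in unitmx.
Proof. by rewrite unitmx_inv GL_unit. Qed.
Definition GL_inv A : GL := MkGL (GL_inv_subproof A).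

Lemma GL_mulA : associative GL_mul.
Proof. by move=> A B C; apply: val_inj; rewrite /= mulmxA. Qed.
Lemma GL_mul1g : left_id GL_one GL_mul.
Proof. by move=> A; apply: val_inj; rewrite /= mul1mx. Qed.
Lemma GL_mulg1 : right_id GL_one GL_mul.
Proof. by move=> A; apply: val_inj; rewrite /= mulmx1. Qed.
Lemma GL_mulVg : left_inverse GL_one GL_inv GL_mul.
Proof. by move=> A; apply: val_inj; rewrite /= mulVmx ?GL_unit. Qed.
Lemma GL_mulgV : right_inverse GL_one GL_inv GL_mul.
Proof. by move=> A; apply: val_inj; rewrite /= mulmxV ?GL_unit. Qed.

HB.instance Definition _ := isGroup.Build GL
  GL_mulA GL_mul1g GL_mulg1 GL_mulVg GL_mulgV.

Definition proj_eq A B : Prop :=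
  exists2 c : F, (c != 0)%R & GLmx A = (c *: GLmx B)%R.
Definition proj_eqb : rel GL := fun A B => `[< proj_eq A B >].

Lemma proj_eqb_refl : reflexive proj_eqb.
Proof.
by move=> A; apply/asboolP; exists 1%R; rewrite ?oner_eq0 ?scale1r.
Qed.

Lemma proj_eqb_sym : symmetric proj_eqb.
Proof.
suff h A B : proj_eq A B -> proj_eq B A by move=> A B; apply/asboolP/asboolP; exact: h.
move=> [c c0 e]; exists c^-1%R; first by rewrite invr_eq0.
by rewrite e scalerA mulVf ?scale1r.
Qed.

Lemma proj_eqb_trans : transitive proj_eqb.
Proof.
move=> B A C /asboolP[c c0 e] /asboolP[d d0 e']; apply/asboolP.
by exists (c * d)%R; [rewrite mulf_neq0|rewrite e e' scalerA].
Qed.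

Canonical proj_equiv := EquivRel proj_eqb proj_eqb_refl proj_eqb_sym
  proj_eqb_trans.

Definition PGL := {eq_quot proj_equiv}%qT.
HB.instance Definition _ := Choice.on PGL.
HB.instance Definition _ := EqQuotient.on PGL.

Definition PGL_class A : PGL := \pi A.

Lemma PGL_classP A B : PGL_class A = PGL_class B <-> proj_eq A B.
Proof. by split=> [/eqmodP/asboolP|uv] //; apply/eqmodP/asboolP. Qed.

Lemma PGL_reprK (x : PGL) : PGL_class (repr x) = x.
Proof. exact: reprK. Qed.

Lemma PGL_class_ind (P : PGL -> Prop) :
  (forall A, P (PGL_class A)) -> forall x, P x.
Proof. by move=> h x; rewrite -(PGL_reprK x). Qed.

Definition PGL_one : PGL := PGL_class 1.
Definition PGL_mul (x y : PGL) : PGL := PGL_class (repr x * repr y).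
Definition PGL_inv (x : PGL) : PGL := PGL_class (repr x)^-1.

Lemma PGL_mulE A B : PGL_mul (PGL_class A) (PGL_class B) = PGL_class (A * B).
Proof.
have /PGL_classP[c c0 e] := PGL_reprK (PGL_class A).
have /PGL_classP[d d0 e'] := PGL_reprK (PGL_class B).
apply/PGL_classP; exists (c * d)%R; first by rewrite mulf_neq0.
by rewrite /= e e' -scalemxAl -scalemxAr scalerA.
Qed.

Lemma PGL_invE A : PGL_inv (PGL_class A) = PGL_class A^-1.
Proof.
have /PGL_classP[c c0 e] := PGL_reprK (PGL_class A).
apply/PGL_classP; exists c^-1%R; first by rewrite invr_eq0.
by rewrite /= e invmxZ // unitmxZ ?unitfE ?GL_unit.
Qed.

Lemma PGL_mulA : associative PGL_mul.
Proof.
elim/PGL_class_ind=> A; elim/PGL_class_ind=> B; elim/PGL_class_ind=> C.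
by rewrite !PGL_mulE mulgA.
Qed.

Lemma PGL_mul1g : left_id PGL_one PGL_mul.
Proof. by elim/PGL_class_ind=> A; rewrite PGL_mulE mul1g. Qed.

Lemma PGL_mulg1 : right_id PGL_one PGL_mul.
Proof. by elim/PGL_class_ind=> A; rewrite PGL_mulE mulg1. Qed.

Lemma PGL_mulVg : left_inverse PGL_one PGL_inv PGL_mul.
Proof. by elim/PGL_class_ind=> A; rewrite PGL_invE PGL_mulE mulVg. Qed.

Lemma PGL_mulgV : right_inverse PGL_one PGL_inv PGL_mul.
Proof. by elim/PGL_class_ind=> A; rewrite PGL_invE PGL_mulE mulgV. Qed.

HB.instance Definition _ := isGroup.Build PGL
  PGL_mulA PGL_mul1g PGL_mulg1 PGL_mulVg PGL_mulgV.

Lemma PGL_class_morphism : monoid.monoid_morphism PGL_class.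
Proof. by split=> // A B; rewrite -PGL_mulE. Qed.

HB.instance Definition _ :=
  isUMagmaMorphism.Build GL PGL PGL_class PGL_class_morphism.

End ProjectiveLinear.

Local Open Scope ring_scope.

Definition mx3 (K : nzRingType) (rows : seq (seq K)) : 'M[K]_3 :=
  \matrix_(i < 3, j < 3) nth 0 (nth [::] rows i) j.

Lemma mx3_mul (K : nzRingType) (a b c d e f g h i a' b' c' d' e' f' g' h' i' : K) :
  mx3 [:: [:: a; b; c]; [:: d; e; f]; [:: g; h; i]] *m
  mx3 [:: [:: a'; b'; c']; [:: d'; e'; f']; [:: g'; h'; i']] =
  mx3 [:: [:: a * a' + b * d' + c * g'; a * b' + b * e' + c * h';
              a * c' + b * f' + c * i'];
          [:: d * a' + e * d' + f * g'; d * b' + e * e' + f * h';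
              d * c' + e * f' + f * i'];
          [:: g * a' + h * d' + i * g'; g * b' + h * e' + i * h';
              g * c' + h * f' + i * i']].
Proof.
apply/matrixP=> -[[|[|[|?]]] ?] -[[|[|[|?]]] ?] //.
all: by rewrite !mxE !big_ord_recl big_ord0 !mxE /= addr0 !addrA.
Qed.

Lemma mx3_1 (K : nzRingType) :
  mx3 [:: [:: 1; 0; 0]; [:: 0; 1; 0]; [:: 0; 0; 1]] = 1%:M :> 'M[K]_3.
Proof.
by apply/matrixP=> -[[|[|[|?]]] ?] -[[|[|[|?]]] ?] //; rewrite !mxE.
Qed.

Section EisensteinPicard.
Variable R : realType.
Local Notation C := R[i].

Definition omega3 : C := Complex (- 2^-1) (Num.sqrt 3 / 2).

(* Z[omega3]: the values at omega3 of integer polynomials. *)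
Definition O3 : set C :=
  [set z | exists p : {poly int}, z = (map_poly (fun a : int => a%:~R) p).[omega3]].

Definition herm (Z W : 'cV[C]_3) : C :=
  Z 0 0 * (W 2 0)^* + Z 1 0 * (W 1 0)^* + Z 2 0 * (W 0 0)^*.

Definition U21 : set 'M[C]_3 :=
  [set A | forall Z W : 'cV[C]_3, herm (A *m Z) (A *m W) = herm Z W].

Definition PU21 : set (PGL C 3) :=
  [set x | exists2 A : GL C 3, U21 A & x = PGL_class A].

Definition PU21_O3 : set (PGL C 3) :=
  PU21 `&` [set x | exists A : GL C 3,
    [/\ U21 A, forall i j, O3 (A i j) & x = PGL_class A]].

Definition rho1_mx1 : 'M[C]_3 :=
  mx3 [:: [:: 1; 1; Complex (- 2^-1) (- (Num.sqrt 3 / 2))];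
          [:: 0; 1; -1];
          [:: 0; 0; 1]].

Definition rho1_mx3 : 'M[C]_3 :=
  mx3 [:: [:: 1; 0; 0];
          [:: 1; 1; 0];
          [:: Complex (- 2^-1) (- (Num.sqrt 3 / 2)); -1; 1]].

Local Notation a := (Complex (- 2^-1) (- (Num.sqrt 3 / 2)) : C).

Lemma rho1_entry_sqr : a * a = - a - 1.
Proof.
have h3 : Num.sqrt 3 * Num.sqrt 3 = 3 :> R by rewrite -expr2 sqr_sqrtr.
set s := Num.sqrt 3 in h3 *.
have -> : - a - 1 = Complex (- - 2^-1 - 1) (- - (s / 2) - 0) :> C by [].
have -> : a * a = Complex (- 2^-1 * - 2^-1 - - (s / 2) * - (s / 2))
  (- 2^-1 * - (s / 2) + - (s / 2) * - 2^-1) :> C by [].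
by congr Complex; field: h3.
Qed.

Definition rho1_mx1V : 'M[C]_3 :=
  mx3 [:: [:: 1; -1; - a - 1]; [:: 0; 1; 1]; [:: 0; 0; 1]].
Definition rho1_mx3V : 'M[C]_3 :=
  mx3 [:: [:: 1; 0; 0]; [:: -1; 1; 0]; [:: - a - 1; 1; 1]].

Lemma rho1_mx1K : rho1_mx1 *m rho1_mx1V = 1%:M.
Proof.
rewrite mx3_mul -mx3_1.
by congr (mx3 [:: [:: _; _; _]; [:: _; _; _]; [:: _; _; _]]);
  ring: rho1_entry_sqr.
Qed.

Lemma rho1_mx3K : rho1_mx3 *m rho1_mx3V = 1%:M.
Proof.
rewrite mx3_mul -mx3_1.
by congr (mx3 [:: [:: _; _; _]; [:: _; _; _]; [:: _; _; _]]);
  ring: rho1_entry_sqr.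
Qed.

Definition rho1_GL1 : GL C 3 := MkGL (mulmx1_unit rho1_mx1K).1.
Definition rho1_GL3 : GL C 3 := MkGL (mulmx1_unit rho1_mx3K).1.

Definition rho1_gens (b : bool) : PGL C 3 :=
  if b then PGL_class rho1_GL1 else PGL_class rho1_GL3.

Lemma rho1_mx_rel :
  rho1_mx3 *m rho1_mx1V *m rho1_mx3V *m rho1_mx1 *m rho1_mx3 =
  rho1_mx1 *m (rho1_mx3 *m rho1_mx1V *m rho1_mx3V *m rho1_mx1).
Proof.
rewrite !mx3_mul.
by congr (mx3 [:: [:: _; _; _]; [:: _; _; _]; [:: _; _; _]]);
  ring: rho1_entry_sqr.
Qed.

Lemma rho1_rels u v : (u, v) \in fig8_rels ->
  weval rho1_gens u = weval rho1_gens v.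
Proof.
have V1 : invmx rho1_mx1 = rho1_mx1V.
  by rewrite -[LHS]mulmx1 -rho1_mx1K mulKmx // (mulmx1_unit rho1_mx1K).1.
have V3 : invmx rho1_mx3 = rho1_mx3V.
  by rewrite -[LHS]mulmx1 -rho1_mx3K mulKmx // (mulmx1_unit rho1_mx3K).1.
have e : (grp_comm rho1_GL3 rho1_GL1^-1 * rho1_GL3 =
          rho1_GL1 * grp_comm rho1_GL3 rho1_GL1^-1)%g.
  rewrite /grp_comm invgK; apply: val_inj.
  by rewrite /= V1 V3 rho1_mx_rel.
have ev : weval rho1_gens (wcomm (wgen false) (winv (wgen true)) ++ wgen false)
    = weval rho1_gens (wgen true ++ wcomm (wgen false) (winv (wgen true))).
  rewrite (weval_cat _ (wcomm _ _)) (weval_cat _ (wgen true)).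
  rewrite !weval_grp_comm !weval_inv !weval_gen.
  by move: (congr1 (@PGL_class C 3) e); rewrite /grp_comm !(gmulfM, gmulfV).
by rewrite mem_seq1 => /eqP uv; rewrite (congr1 fst uv : u = _) (congr1 snd uv : v = _).
Qed.

Definition rho1 : Gamma -> PGL C 3 := pres_lift rho1_rels.
HB.instance Definition _ :=
  isUMagmaMorphism.Build Gamma (PGL C 3) rho1 (pres_lift_morphism rho1_rels).

Lemma rho1_g1 : rho1 g1 = PGL_class rho1_GL1.
Proof. exact: pres_lift_gen. Qed.

Lemma rho1_g3 : rho1 g3 = PGL_class rho1_GL3.
Proof. exact: pres_lift_gen. Qed.

End EisensteinPicard.

(* Main.v *)
(* Let J be the antidiagonal matrix (1, -1, 1), so that rho1(g3) = J rho1(g1) J.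
   Adding the relation J = 1 to PU(2,1;O3) yields the Euclidean triangle group
   (2,3,6), acting on C: the stabilizer of the cusp at infinity, generated by
   Heisenberg translations T(t1, t2) and rotations, acts through the horizontal
   translation by t1.  Under this quotient map rho1(g1) and rho1(g3) both become
   the translation by -1.  Hence rho1(Gamma) maps onto Z, so its derived subgroup
   has infinite index, while the translations by multiples of omega3 show that
   Z has infinite index in the image of PU(2,1;O3).

   Instead of a presentation of PU(2,1;O3), the image of the point 0 under this
   quotient map is computed by a Euclidean algorithm on the first column v of a
   matrix: move v by a Heisenberg translation so that |v_1| < |v_3|, then swap
   with J.  The result does not depend on the choices made because the integral
   Heisenberg points within Cygan distance 1 of a given point are connected
   through pairs at distance 1, and J T J = m T' J T'' (m a unit) for the
   translations T relating such pairs, with translation parts adding up. *)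
Require Import Defs.
From mathcomp Require Import all_boot all_order all_algebra.
From mathcomp Require Import ring lra zify.
From mathcomp Require Import boolp classical_sets cardinality reals.
From mathcomp Require Import complex.

Set Implicit Arguments.
Unset Strict Implicit.
Unset Printing Implicit Defensive.

Import Order.TTheory GRing.Theory Num.Theory.

Local Open Scope ring_scope.
Local Open Scope classical_set_scope.

(** * Inequalities between Cygan distances *)

Section RealIneq.
Variable R : realFieldType.
Implicit Types X y s q u t b : R.

(* The three expressions bounded below are half the change of [cyg] under the
   three moves of [descent_sector]. *)
Lemma sector_large_s X y s q : q = X * X + 3 * y * y -> q <= 2 ->
  - X <= 3 * y -> 3 * y <= X -> 3 / 4 <= s -> s * s <= 4 / 3 ->
  3 * q - 1 - 2 * X - 2 * X * q + 3 * (1 - s) * (1 - 2 * y) < 0.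
Proof.
move=> eq q2 y1 y2 s1 s2.
have X0 : 0 <= X by lra.
have X1 : X <= 142 / 100 by nra.
have s3 : s <= 116 / 100 by nra.
have q3 : q <= 4 / 3 * X * X by nra.
have q4 : q * (3 - 2 * X) <= 4 / 3 * X * X * (3 - 2 * X) by nra.
have h : 0 <= X * (X - 3 / 4) ^+ 2 by rewrite mulr_ge0 ?sqr_ge0.
have [s4|s4] := lerP s 1.
  have h1 : (1 - s) * (1 - 2 * y) <= (1 - s) * (1 + 2 / 3 * X) by nra.
  have h2 : 9 / 4 + 3 / 2 * X <= 3 * s + 2 * X * s by nra.
  nra.
have h1 : (1 - s) * (1 - 2 * y) <= 0 by nra.
have [h2|h2] := lerP X (1 / 2); nra.
Qed.

Lemma lb_sqr (c x : R) : 0 <= x -> c * c <= x * x -> c <= x.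
Proof. by move=> x0 h; rewrite leNgt; apply/negP => xc; nra. Qed.

Lemma sector_small_X X y s q : q = X * X + 3 * y * y -> X <= 11 / 10 ->
  0 <= y -> 3 * y <= X -> 0 <= s -> s <= 3 / 4 -> 2 <= q * q + 3 * s * s ->
  3 * q - 1 - 2 * X - 2 * X * q + 3 * (1 - s) * (1 - 2 * y) < 0.
Proof.
move=> eq X1 y0 y1 s0 s1 D2; rewrite ltNge; apply/negP => f0.
have X0 : 0 <= X by lra.
have q1 : 11 / 20 <= q by nra.
have q3 : q <= 4 / 3 * X * X by nra.
have X2 : 64 / 100 <= X by nra.
have E : 3 * q - 1 - 2 * X - 2 * X * q + 3 * (1 - s) * (1 - 2 * y) =
  3 * X ^+ 2 - 2 * X ^+ 3 + 2 - 2 * X - 3 * s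
    + 3 * y * ((3 - 2 * X) * y - 2 * (1 - s)) by rewrite eq; ring.
rewrite E {E} in f0.
set b := (3 - 2 * X) * y - 2 * (1 - s) in f0.
have b0 : b <= 0 by rewrite /b; nra.
have yb : y * b <= 0 by rewrite mulr_ge0_le0.
(* Recentred at its inflection point 1/2, the cubic in X is visibly decreasing, so a lower bound on
   X bounds s from above. *)
have hb : 3 * s <= 7 / 4 - X / 2 - 2 * (X - 1 / 2) ^+ 3 + 3 * (y * b).
  have -> : 7 / 4 - X / 2 - 2 * (X - 1 / 2) ^+ 3 =
     3 * X ^+ 2 - 2 * X ^+ 3 + 2 - 2 * X by field.
  by rewrite mulrA; lra.
have q0 : 0 <= q by lra.
(* The factor 11/30 bounds y, from [3 * y <= X] and [X <= 11 / 10]. *)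
have bX Xm sm bm : Xm <= X -> s <= sm -> (3 - 2 * Xm) * (11 / 30) - 2 * (1 - sm) <= bm ->
    b <= bm.
  by rewrite /b => h1 h2; apply: le_trans; nra.
clearbody b; clear f0 q1 X0.
(* Each round turns a lower bound Xm of X and an upper bound - k of y b into a
   better lower bound of X, until s < 0 is forced. *)
have round Xm k sm qm Xm' : Xm <= X -> y * b <= - k -> 1 / 2 <= Xm ->
    7 / 4 - Xm / 2 - 2 * (Xm - 1 / 2) ^+ 3 - 3 * k <= 3 * sm ->
    qm * qm + 3 * sm * sm <= 2 -> Xm' * Xm' <= 3 / 4 * qm ->
    [/\ s <= sm, qm <= q & Xm' <= X].
  move=> hX hk h1 h2 h3 h4.
  have c1 : (Xm - 1 / 2) ^+ 3 <= (X - 1 / 2) ^+ 3.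
    by rewrite lerXn2r ?nnegrE ?lerB //; clear - h1 hX; lra.
  have ss : s <= sm by clear - h2 hb c1 hX hk; lra.
  have qq : qm <= q by apply: lb_sqr => //; clear - h3 ss s0 D2; nra.
  by split=> //; apply: lb_sqr; clear - X2 q3 h4 qq; lra.
have yround sm qm Xm ym bm : [/\ s <= sm, qm <= q & Xm <= X] ->
    3 * ym * ym + 121 / 100 <= qm -> 0 <= ym -> 0 <= bm ->
    (3 - 2 * Xm) * (11 / 30) - 2 * (1 - sm) <= - bm -> y * b <= - (ym * bm).
  move=> [h1 h2 h3] h4 h5 h6 /(bX _ _ _ h3 h1) h7.
  have h8 : ym <= y.
    by apply: lb_sqr => //; clear - X1 X2 eq h4 h2; nra.
  by clear - h5 h6 h7 h8; nra.
have yb0 : y * b <= - 0 by rewrite oppr0.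
have [||||_ _ X3] := round _ _ (48 / 100) (114 / 100) (92 / 100) X2 yb0;
  try by clear; lra.
have [||||_ _ X4] := round _ _ (385 / 1000) (124 / 100) (96 / 100) X3 yb0;
  try by clear; lra.
have [||||s5 q5 X5] := round _ _ (36 / 100) (126 / 100) (97 / 100) X4 yb0;
  try by clear; lra.
have := yround _ _ _ (12 / 100) (88 / 100) (And3 s5 q5 X5).
move=> /(_ _ _ _ _)/wrap[||||yb1]; try by clear; lra.
have [||||s6 q6 X6] := round _ _ (26 / 100) (133 / 100) (99 / 100) X5 yb1;
  try by clear; lra.
have := yround _ _ _ (20 / 100) (107 / 100) (And3 s6 q6 X6).
move=> /(_ _ _ _ _)/wrap[||||yb2]; try by clear; lra.
have [||||s7 q7 X7] := round _ _ (14 / 100) (139 / 100) (102 / 100) X6 yb2;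
  try by clear; lra.
have := yround _ _ _ (24 / 100) (136 / 100) (And3 s7 q7 X7).
move=> /(_ _ _ _ _)/wrap[||||yb3]; try by clear; lra.
(* The two zeros are dummy bounds; only the negative upper bound on s is kept. *)
have [||||s8 _ _] := round _ _ (- (1 / 1000)) 0 0 X7 yb3; try by clear; lra.
by clear - s8 s0; lra.
Qed.

Lemma sector_large_X X y s q : q = X * X + 3 * y * y -> 11 / 10 <= X ->
  0 <= y -> 3 * y <= X -> 0 <= s -> s <= 3 / 4 ->
  3 * q - 1 - (X + 3 * y) * (1 + q) + 3 * (1 + s) * (1 + y - X) < 0.
Proof.
move=> eq X1 y0 y1 s0 s1.
(* In powers of X - 1 no term is positive, and - (X - 1) is strictly negative. *)
have -> : 3 * q - 1 - (X + 3 * y) * (1 + q) + 3 * (1 + s) * (1 + y - X) =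
  - (X - 1) ^+ 3 - (X - 1) - 3 * s * (X - 1)
  + 3 * y * ((3 - X) * y - X ^+ 2 - 3 * y ^+ 2 + s) by rewrite eq; ring.
have h1 : 0 <= (X - 1) ^+ 3 by rewrite exprn_ge0 //; lra.
have h2 : (3 - X) * y - X ^+ 2 - 3 * y ^+ 2 + s <= 0 by nra.
nra.
Qed.


(** Here X = 1 + u and y = - t. If the second move fails too, then 2 t <= u (3 s - 1), so t is so
    small compared with u that the failure of the first move is contradicted. *)
Lemma sector_neg_y_right u t s b q : q = (1 + u) * (1 + u) + 3 * t * t ->
  q <= 2 -> 0 <= u -> 0 <= t -> 0 <= s -> s <= 3 / 4 -> 2 <= q * q + 3 * s * s ->
  b = (2 - u) * t - (1 + u) ^+ 2 - 3 * t ^+ 2 - s ->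
  0 <= 1 - 2 * u - 3 * u ^+ 2 - 2 * u ^+ 3 - 3 * s
    + 3 * t * ((1 - 2 * u) * t + 2 * (1 - s)) ->
  u * (3 * s - 1) - u ^+ 3 + 3 * (t * b) < 0.
Proof.
move=> eq q2 u0 t0 s0 s1 D2 eb f1; rewrite ltNge; apply/negP => f2.
have u1 : u <= 42 / 100 by nra.
have b1 : b <= - (2 / 3) - s by rewrite eb; nra.
have u3 : 0 <= u ^+ 3 by rewrite exprn_ge0.
have tb : 2 * t <= u * (3 * s - 1) by nra.
have [u2|u2] := lerP u 0.
  have u4 : u = 0 by lra.
  have t2 : t = 0 by move: tb; rewrite u4; lra.
  rewrite u4 t2 in f1 eq.
  have q5 : q = 1 by rewrite eq; ring.
  have s2 : s <= 1 / 3 by lra.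
  by move: D2; rewrite q5; nra.
have s2 : 0 <= 3 * s - 1 by nra.
have h1 : t * (1 - s) * 6 <= u.
  have h3 : (3 * s - 1) * (1 - s) <= 1 / 3.
    by have := sqr_ge0 (s - 2 / 3); nra.
  have h4 : t * (1 - s) * 2 <= u * (3 * s - 1) * (1 - s) by nra.
  by nra.
have h2 : t * t <= u * u / 2.
  have h3 : t <= u * (5 / 8) by nra.
  by nra.
have h5 : 0 <= u * (t * t) by rewrite mulr_ge0 // mulr_ge0.
clear - f1 u2 u3 s2 h1 h2 h5.
by nra.
Qed.

(** Here X = 1 - u and y = - t. Failure of the second move bounds s, hence makes q large, X close to
    1 and t at least 3/10; then t b is too negative. *)
Lemma sector_neg_y_left u t s b q : q = (1 - u) * (1 - u) + 3 * t * t ->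
  0 < u -> u <= 36 / 100 -> 0 <= t -> 3 * t <= 1 - u -> 0 <= s ->
  2 <= q * q + 3 * s * s -> b = (2 + u) * t - (1 - u) ^+ 2 - 3 * t ^+ 2 - s ->
  u ^+ 3 + u - 3 * s * u + 3 * (t * b) < 0.
Proof.
move=> eq u0 u1 t0 t1 s0 D2 eb; rewrite ltNge; apply/negP => f2.
have q0 : 0 <= q by nra.
have q3 : q <= 4 / 3 * (1 - u) * (1 - u) by nra.
have b0 : b <= 0.
  have [u2|u2] := lerP u (1 / 4); first by rewrite eb; nra.
  have q4 : q <= 3 / 4 by nra.
  have s2 : 2 / 3 <= s by apply: lb_sqr => //; nra.
  by rewrite eb; nra.
have tb : t * b <= 0 by rewrite mulr_ge0_le0.
have us : 3 * s <= 1 + u * u by nra.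
have s2 : s <= 377 / 1000 by nra.
have q4 : 125 / 100 <= q by apply: lb_sqr => //; nra.
have X3 : 968 / 1000 <= 1 - u by apply: lb_sqr; lra.
have u2 : u <= 32 / 1000 by lra.
have s3 : s <= 334 / 1000 by nra.
have q5 : 129 / 100 <= q by apply: lb_sqr => //; nra.
have t2 : 30 / 100 <= t by apply: lb_sqr => //; nra.
have b1 : b <= - (1 / 2) by rewrite eb; nra.
have tb1 : t * b <= - (15 / 100) by nra.
clear - f2 tb1 u0 u2 s0.
by nra.
Qed.

Lemma sector_neg_y X t s q : q = X * X + 3 * t * t -> q <= 2 ->
  0 <= t -> 3 * t <= X -> 0 <= s -> s <= 3 / 4 -> 2 <= q * q + 3 * s * s ->
  0 <= 3 * q - 1 - 2 * X - 2 * X * q + 3 * (1 - s) * (1 + 2 * t) ->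
  3 * q - 1 - (X + 3 * t) * (1 + q) + 3 * (1 - s) * (1 - X + t) < 0.
Proof.
move=> eq q2 t0 t1 s0 s1 D2 f1.
have X0 : 0 <= X by lra.
have q0 : 0 <= q by nra.
have q3 : q <= 4 / 3 * X * X by nra.
have q1 : 55 / 100 <= q by apply: lb_sqr => //; nra.
have X1 : 64 / 100 <= X by apply: lb_sqr => //; lra.
have [X2|X2] := lerP 1 X.
  have eX : X = 1 + (X - 1) by ring.
  have eq' := eq; rewrite {1 2}eX in eq'.
  have u0 : 0 <= X - 1 by lra.
  have := sector_neg_y_right eq' q2 u0 t0 s0 s1 D2 erefl _.
  set g := _ + 3 * (t * _); have -> : g = 3 * q - 1 - (X + 3 * t) * (1 + q) + 3 * (1 - s) * (1 - X + t).
    by rewrite /g eq; ring.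
  by apply; apply: le_trans f1 _; rewrite le_eqVlt; apply/orP; left; apply/eqP; rewrite eq; ring.
have eX : X = 1 - (1 - X) by ring.
have eq' := eq; rewrite {1 2}eX in eq'.
have [u0 u1] : 0 < 1 - X /\ 1 - X <= 36 / 100 by split; lra.
have t1' : 3 * t <= 1 - (1 - X) by lra.
have := sector_neg_y_left eq' u0 u1 t0 t1' s0 D2 erefl.
by set g := _ + _; have -> : g = 3 * q - 1 - (X + 3 * t) * (1 + q) + 3 * (1 - s) * (1 - X + t)
  by rewrite /g eq; ring.
Qed.

End RealIneq.

(** * Descent and midpoint estimates for the Cygan norm *)

Section Cygan.
Variable R : realFieldType.
Implicit Types X y s q u t b A d e r : R.

(* With z2 = X + i sqrt 3 y and z1 = (- |z2|^2 + i sqrt 3 s) / 2, the vector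
   (z1, z2, 1) is isotropic and |z1|^2 = cyg X y s / 4. *)
Definition cyg X y s : R := (X * X + 3 * y * y) ^+ 2 + 3 * s ^+ 2.

Definition lower_adj A d e X y s : Prop :=
  cyg (X + A) (y + d) (s + e - 2 * (A * y - d * X)) < cyg X y s.

(** The sector is the set of z2 within 30 degrees of the positive real axis. The moves use the unit
    opposite to that axis and its two neighbours among the sixth roots of unity. *)
Lemma descent_sector X y s : - X <= 3 * y -> 3 * y <= X -> 0 <= s ->
  2 <= cyg X y s -> cyg X y s <= 4 ->
  [\/ lower_adj (- 1) 0 (- 1) X y s,
      lower_adj (- (1 / 2)) (1 / 2) (- 1) X y s |
      lower_adj (- (1 / 2)) (- (1 / 2)) 1 X y s].
Proof.
rewrite /cyg => y1 y2 s0 D2 D4.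
set q := X * X + 3 * y * y in D2 D4.
have eq : q = X * X + 3 * y * y by [].
have q0 : 0 <= q by rewrite eq; nra.
have q2 : q <= 2 by clear - q0 D4; nra.
have sD : 2 <= q * q + 3 * s * s by clear - D2; lra.
have s2 : s * s <= 4 / 3 by clear - D4; nra.
pose f1 := 3 * q - 1 - 2 * X - 2 * X * q + 3 * (1 - s) * (1 - 2 * y).
pose f2 := 3 * q - 1 - (X - 3 * y) * (1 + q) + 3 * (1 - s) * (1 - X - y).
pose f3 := 3 * q - 1 - (X + 3 * y) * (1 + q) + 3 * (1 + s) * (1 + y - X).
have e1 : f1 < 0 -> lower_adj (- 1) 0 (- 1) X y s.
  move=> h; rewrite /lower_adj -subr_lt0.
  have -> : cyg (X + - 1) (y + 0) (s + - 1 - 2 * (- 1 * y - 0 * X)) - cyg X y s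
    = 2 * f1 by rewrite /f1 /cyg eq; ring.
  by clear - h; lra.
have e2 : f2 < 0 -> lower_adj (- (1 / 2)) (1 / 2) (- 1) X y s.
  move=> h; rewrite /lower_adj -subr_lt0.
  have -> : cyg (X + - (1 / 2)) (y + 1 / 2)
    (s + - 1 - 2 * (- (1 / 2) * y - 1 / 2 * X)) - cyg X y s
    = 2 * f2 by rewrite /f2 /cyg eq; field.
  by clear - h; lra.
have e3 : f3 < 0 -> lower_adj (- (1 / 2)) (- (1 / 2)) 1 X y s.
  move=> h; rewrite /lower_adj -subr_lt0.
  have -> : cyg (X + - (1 / 2)) (y + - (1 / 2))
    (s + 1 - 2 * (- (1 / 2) * y - - (1 / 2) * X)) - cyg X y s
    = 2 * f3 by rewrite /f3 /cyg eq; field.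
  by clear - h; lra.
have [s1|s1] := lerP (3 / 4) s.
  by apply/Or31/e1; rewrite /f1; exact: sector_large_s.
have [y0|y0] := lerP 0 y.
  have [X1|X1] := lerP X (11 / 10).
    by apply/Or31/e1; rewrite /f1; apply: sector_small_X => //; exact: ltW.
  by apply/Or33/e3; rewrite /f3; apply: sector_large_X => //; exact: ltW.
have [h|h] := ltP f1 0; first exact/Or31/e1.
apply/Or32/e2.
have -> : f2 = 3 * q - 1 - (X + 3 * - y) * (1 + q) + 3 * (1 - s) * (1 - X + - y).
  by rewrite /f2; ring.
apply: sector_neg_y => //; try (by clear - y1 y0 s1; lra); first by rewrite eq; ring.
by rewrite (_ : _ + _ = f1) // /f1; ring.
Qed.

(** The units of the Eisenstein integers, with A + i sqrt 3 d recorded as (A, d). *)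
Definition units6 : seq (R * R) :=
  [:: (1, 0); (1 / 2, 1 / 2); (- (1 / 2), 1 / 2);
      (- 1, 0); (- (1 / 2), - (1 / 2)); (1 / 2, - (1 / 2))].

Definition has_lower_adj X y s : Prop := exists A d e,
  [/\ (A, d) \in units6, e = 1 \/ e = - 1 & lower_adj A d e X y s].

Lemma has_lower_adj_conj X y s : has_lower_adj X (- y) (- s) -> has_lower_adj X y s.
Proof.
move=> [A [d [e [Ad ee h]]]]; exists A, (- d), (- e); split.
- move: Ad; rewrite !inE !xpair_eqE.
  by case/or4P=> [g|g|g|/or3P[g|g|g]]; case/andP: g => /eqP-> /eqP->;
    rewrite ?oppr0 ?opprK !eqxx ?orbT.
- by case: ee => ->; [right|left]; rewrite ?opprK.
- move: h; rewrite /lower_adj /cyg.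
  by congr (_ < _); ring.
Qed.

(** The new coordinates are those of z2 multiplied by exp(- i pi / 3), a rotation that permutes the
    six units. *)
Lemma has_lower_adj_rot X y s :
  has_lower_adj (X / 2 + 3 / 2 * y) (y / 2 - X / 2) s -> has_lower_adj X y s.
Proof.
move=> [A [d [e [Ad ee h]]]]; exists (A / 2 - 3 / 2 * d), (d / 2 + A / 2), e; split=> //.
- move: Ad; rewrite !inE !xpair_eqE.
  case/or4P=> [g|g|g|/or3P[g|g|g]]; case/andP: g => /eqP-> /eqP->; apply/or4P.
  + by apply: Or42; apply/andP; split; apply/eqP; field.
  + by apply: Or43; apply/andP; split; apply/eqP; field.
  + by apply/Or44/or3P/Or31; apply/andP; split; apply/eqP; field.
  + by apply/Or44/or3P/Or32; apply/andP; split; apply/eqP; field.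
  + by apply/Or44/or3P/Or33; apply/andP; split; apply/eqP; field.
  + by apply: Or41; apply/andP; split; apply/eqP; field.
- move: h; rewrite /lower_adj /cyg.
  by congr (_ < _); field.
Qed.

Lemma cyg_rot X y s : cyg (X / 2 + 3 / 2 * y) (y / 2 - X / 2) s = cyg X y s.
Proof. by rewrite /cyg; field. Qed.

Lemma has_lower_adjP X y s : 2 <= cyg X y s -> cyg X y s <= 4 -> has_lower_adj X y s.
Proof.
have sector X' y' s' : - X' <= 3 * y' -> 3 * y' <= X' ->
    2 <= cyg X' y' s' -> cyg X' y' s' <= 4 -> has_lower_adj X' y' s'.
  have pos Z z r : - Z <= 3 * z -> 3 * z <= Z -> 0 <= r ->
      2 <= cyg Z z r -> cyg Z z r <= 4 -> has_lower_adj Z z r.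
    move=> h1 h2 h3 h4 h5; case: (descent_sector h1 h2 h3 h4 h5) => h.
    - by exists (- 1), 0, (- 1); split=> //; [rewrite !inE eqxx !orbT|right].
    - by exists (- (1 / 2)), (1 / 2), (- 1); split=> //; [rewrite !inE eqxx !orbT|right].
    - by exists (- (1 / 2)), (- (1 / 2)), 1; split=> //; [rewrite !inE eqxx !orbT|left].
  move=> h1 h2 h3 h4; have [s0|s0] := lerP 0 s'; first exact: pos.
  apply: has_lower_adj_conj; have e : cyg X' (- y') (- s') = cyg X' y' s'.
    by rewrite /cyg; ring.
  by apply: pos; rewrite ?e //; lra.
move=> h1 h2.
have rot X' y' s' : cyg X' y' s' = cyg X y s ->
  (cyg (X' / 2 + 3 / 2 * y') (y' / 2 - X' / 2) s' = cyg X y s ->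
     has_lower_adj (X' / 2 + 3 / 2 * y') (y' / 2 - X' / 2) s') ->
  has_lower_adj X' y' s'.
  by move=> e h; apply/has_lower_adj_rot/h; rewrite cyg_rot.
have fin X' y' s' : - X' <= 3 * y' -> 3 * y' <= X' -> cyg X' y' s' = cyg X y s ->
  has_lower_adj X' y' s' by move=> ? ? e; apply: sector; rewrite ?e.
(* These signs single out one of six sectors of 60 degrees; between zero and five rotations bring it
   to the sector around the positive axis. *)
have [a1|a1] := lerP (3 * y) X; have [a2|a2] := lerP (- X) (3 * y).
- exact: fin.
- have [a3|a3] := lerP 0 X.
    apply: (rot _ _ _ erefl) => e1; apply: (rot _ _ _ e1) => e2; apply: (rot _ _ _ e2) => e3; apply: (rot _ _ _ e3) => e4; apply: (rot _ _ _ e4) => e5.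
    by apply: fin e5; lra.
  apply: (rot _ _ _ erefl) => e1; apply: (rot _ _ _ e1) => e2; apply: (rot _ _ _ e2) => e3; apply: (rot _ _ _ e3) => e4.
  by apply: fin e4; lra.
- have [a3|a3] := lerP 0 X.
    apply: (rot _ _ _ erefl) => e1.
    by apply: fin e1; lra.
  apply: (rot _ _ _ erefl) => e1; apply: (rot _ _ _ e1) => e2.
  by apply: fin e2; lra.
apply: (rot _ _ _ erefl) => e1; apply: (rot _ _ _ e1) => e2; apply: (rot _ _ _ e2) => e3.
by apply: fin e3; lra.
Qed.

(** A parallelogram identity around the midpoint (x1, y1): if two points are both close to the
    centre, it bounds their difference. *)
Lemma cyg_average X y s A d e :
  let x1 := X + A / 2 in let y1 := y + d / 2 in
  cyg X y s + cyg (X + A) (y + d) (s + e - 2 * (A * y - d * X)) =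
  2 * ((x1 * x1 + 3 * y1 * y1 + (A * A + 3 * d * d) / 4) ^+ 2
    + (A * x1 + 3 * d * y1) ^+ 2 + 3 * (s + e / 2 - (A * y - d * X)) ^+ 2
    + 3 * (e / 2 - (A * y1 - d * x1)) ^+ 2).
Proof. by rewrite /cyg /=; field. Qed.

(* N and e are the coordinates of the difference of two lattice points, r and
   J those of their midpoint relative to the given point. *)
Lemma average_norm r N : 0 <= r -> 0 <= N -> (r + N / 4) ^+ 2 < 2 -> N < 6.
Proof.
move=> r0 N0 H; rewrite ltNge; apply/negP => N6.
have : 3 / 2 <= r + N / 4 by lra.
by nra.
Qed.

Lemma average0 e J : 3 * J ^+ 2 <= 0 -> 3 * (e / 2 - J) ^+ 2 < 2 -> e ^+ 2 < 4.
Proof.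
move=> h; have -> : J = 0.
  by apply/eqP; rewrite -sqrf_eq0; apply/eqP/le_anti; rewrite sqr_ge0 andbT; lra.
have -> : 3 * (e / 2 - 0) ^+ 2 = 3 / 4 * e ^+ 2 by field.
by move=> H; have := sqr_ge0 e; lra.
Qed.

(** The squared norm of the horizontal difference is 1 here, then 3 and 4. A larger vertical
    difference e would force J to be large, hence r by the first hypothesis, against the bound 2. *)
Lemma average1 r e J : 3 * J ^+ 2 <= r -> 0 <= e ->
  (r + 1 / 4) ^+ 2 + 3 * (e / 2 - J) ^+ 2 < 2 -> e < 3.
Proof.
move=> h e0 H; rewrite ltNge; apply/negP => e3.
have sq0 := sqr_ge0 (e / 2 - J).
have J1 : 68 / 100 <= J by nra.
have r1 : 138 / 100 <= r by nra.
by nra.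
Qed.

Lemma average3 r e J : 3 * J ^+ 2 <= 3 * r -> 0 <= e ->
  (r + 3 / 4) ^+ 2 + 3 * (e / 2 - J) ^+ 2 < 2 -> e < 3.
Proof.
move=> h e0 H; rewrite ltNge; apply/negP => e3.
have sq0 := sqr_ge0 (e / 2 - J).
have J1 : 68 / 100 <= J by nra.
have r1 : 46 / 100 <= r by nra.
have H1 : 3 * (e / 2 - J) ^+ 2 < 54 / 100 by nra.
have J2 : 107 / 100 <= J by nra.
have r2 : 114 / 100 <= r by nra.
by nra.
Qed.

Lemma average4 r e J : 3 * J ^+ 2 <= 4 * r -> 0 <= e ->
  (r + 1) ^+ 2 + 3 * (e / 2 - J) ^+ 2 < 2 -> e < 2.
Proof.
move=> h e0 H; rewrite ltNge; apply/negP => e2.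
have sq0 := sqr_ge0 (e / 2 - J).
have r0 : 0 <= r by have := sqr_ge0 J; lra.
have h0 : 3 * (e / 2 - J) ^+ 2 < 1 by nra.
have J1 : 40 / 100 <= J by nra.
have h2 : (r + 1) ^+ 2 < 2 by lra.
have r1 : r <= 42 / 100 by clear - r0 h2; nra.
have J3 : J < 1 by clear - r1 h; nra.
have h1 : (1 - J) ^+ 2 <= (e / 2 - J) ^+ 2 by nra.
by have := sqr_ge0 (J - 2 / 3); nra.
Qed.

(** A difference of squared norm 3 splits into two adjacent translations, and the last expression is
    the Cygan norm of the intermediate point. The sign c is chosen to pull the vertical coordinate
    towards 0. *)
Lemma average3_lower (r P s e J : R) : e = 1 \/ e = - 1 -> P ^+ 2 + 3 * J ^+ 2 = 3 * r ->
  (r + 3 / 4) ^+ 2 + P ^+ 2 + 3 * s ^+ 2 + 3 * (e / 2 - J) ^+ 2 < 2 ->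
  exists2 c, c = 1 \/ c = - 1 &
    (r + 1 / 4 - e * J) ^+ 2 + 3 * (s + c - e * P / 3) ^+ 2 < 4.
Proof.
move=> ee PJ H.
have [j [jJ jE]] : exists j, e * J = j /\ J ^+ 2 = j ^+ 2.
  by exists (e * J); case: ee => ->; split=> //; ring.
have [p [pP pE]] : exists p, e * P / 3 = p /\ P ^+ 2 = 9 * p ^+ 2.
  by exists (e * P / 3); case: ee => ->; split=> //; field.
have eJ : (e / 2 - J) ^+ 2 = (1 / 2 - j) ^+ 2 by rewrite -jJ; case: ee => ->; field.
rewrite jJ pP; rewrite eJ pE in H; rewrite pE jE in PJ; clear - PJ H.
have rj : j ^+ 2 <= r by nra.
have h1 : r ^+ 2 + 9 / 2 * r - 3 * j + 3 * s ^+ 2 < 7 / 10 by nra.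
have r0 : 0 <= r by have := sqr_ge0 j; lra.
have r4 := sqr_ge0 r; have s4 := sqr_ge0 s.
have h5 : 9 / 2 * j ^+ 2 - 3 * j < 7 / 10 by lra.
have j1 : j <= 9 / 10 by clear - h5; nra.
have j0 : - (1 / 5) <= j by clear - h5; nra.
have r1 : r + 1 / 4 - j < 1 by clear - h1 j0 r4 s4; lra.
have r2 : - 1 < r + 1 / 4 - j by clear - r0 j1; lra.
have h2 : (r + 1 / 4 - j) ^+ 2 < 1 by clear - r1 r2; nra.
have j2 := sqr_ge0 (j - 1 / 3).
have s1 : s ^+ 2 <= 121 / 100 by clear - h1 r4 j2 rj; lra.
have p1 : p ^+ 2 <= 36 / 100 by clear - h1 r4 s4 j1 PJ j0; have := sqr_ge0 j; lra.
have [s2 s3] : - (11 / 10) <= s /\ s <= 11 / 10 by clear - s1; split; nra.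
have [p2 p3] : - (6 / 10) <= p /\ p <= 6 / 10 by clear - p1; split; nra.
clear - h2 s2 s3 p2 p3.
have [sp|sp] := lerP 0 (s - p); [exists (- 1); first by right|exists 1; first by left].
  have h3 : s - p <= 2 by lra.
  have h4 : (s + - 1 - p) ^+ 2 <= 1 by clear - sp h3; nra.
  by lra.
have h3 : - 2 <= s - p by lra.
have h4 : (s + 1 - p) ^+ 2 <= 1 by clear - sp h3; nra.
by lra.
Qed.

(** The same for squared norm 4, where the intermediate point lies horizontally at the midpoint. *)
Lemma average4_lower (r P s J : R) : 0 <= r ->
  (r + 1) ^+ 2 + P ^+ 2 + 3 * s ^+ 2 + 3 * (0 / 2 - J) ^+ 2 < 2 ->
  exists2 c, c = 1 \/ c = - 1 & r ^+ 2 + 3 * (s + c) ^+ 2 < 4.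
Proof.
move=> r0 H; have P0 := sqr_ge0 P; have J0 := sqr_ge0 (0 / 2 - J).
have s1 : s ^+ 2 <= 1 by nra.
have r1 : r ^+ 2 < 1 by nra.
have [sp|sp] := lerP 0 s; [exists (- 1); first by right|exists 1; first by left].
  have h4 : (s + - 1) ^+ 2 <= 1 by nra.
  by lra.
have h4 : (s + 1) ^+ 2 <= 1 by nra.
by lra.
Qed.

End Cygan.

(** * Eisenstein integers *)

Section Eisenstein.
Variable R : realType.
Local Notation C := R[i].
Local Notation w := (omega3 R).

Definition sqn (z : C) : R := complex.Re z ^+ 2 + complex.Im z ^+ 2.

Lemma conjD (x y : C) : (x + y)^* = x^* + y^*. Proof. exact: rmorphD. Qed.
Lemma conjN (x : C) : (- x)^* = - x^*. Proof. exact: rmorphN. Qed.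
Lemma conjM (x y : C) : (x * y)^* = x^* * y^*. Proof. exact: rmorphM. Qed.
Lemma conjV (x : C) : (x^-1)^* = (x^*)^-1. Proof. exact: fmorphV. Qed.
Lemma conj_int (a : int) : (a%:~R : C)^* = a%:~R. Proof. exact: rmorph_int. Qed.
Lemma conj0 : 0^* = 0 :> C. Proof. exact: rmorph0. Qed.
Lemma conj1 : 1^* = 1 :> C. Proof. exact: rmorph1. Qed.
Lemma conjK (x : C) : x^*^* = x. Proof. exact: conjCK. Qed.
Definition conjE := (conjD, conjN, conjM, conj_int, conj0, conj1, conjK).

Lemma sqnE z : (sqn z)%:C%C = z * z^*.
Proof. by rewrite -normCK -add_Re2_Im2. Qed.

Lemma sqnM x y : sqn (x * y) = sqn x * sqn y.
Proof. by case: x => a b; case: y => c d; rewrite /sqn /=; ring. Qed.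

Lemma sqn_ge0 z : 0 <= sqn z.
Proof. by rewrite addr_ge0 ?sqr_ge0. Qed.

Lemma sqn_eq0 z : (sqn z == 0) = (z == 0).
Proof.
by rewrite -(inj_eq (@complexI R)) sqnE mulf_eq0 conjC_eq0 orbb.
Qed.

Lemma sqn_gt0 z : (0 < sqn z) = (z != 0).
Proof. by rewrite lt_def sqn_eq0 sqn_ge0 andbT. Qed.

Lemma sqn_conj z : sqn z^* = sqn z.
Proof. by case: z => a b; rewrite /sqn /= sqrrN. Qed.

Lemma sqn1P z : sqn z = 1 -> z * z^* = 1.
Proof. by rewrite -sqnE => ->. Qed.

Lemma sqn1_neq0 z : sqn z = 1 -> z != 0.
Proof. by rewrite -sqn_gt0 => ->. Qed.

Lemma sqrt3_sqr : Num.sqrt 3 * Num.sqrt 3 = 3 :> R.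
Proof. by rewrite -expr2 sqr_sqrtr. Qed.

Lemma omega3_sqr : w * w = - w - 1.
Proof.
have h3 := sqrt3_sqr; rewrite /omega3; set s := Num.sqrt 3 in h3 *.
by apply/eqP; rewrite eq_complex /=; apply/andP; split; apply/eqP; field: h3.
Qed.

Lemma omega3_conj : w^* = - w - 1.
Proof.
by apply/eqP; rewrite eq_complex /=; apply/andP; split; apply/eqP; field.
Qed.

Definition eis (z : C) : Prop := exists a b : int, z = a%:~R + b%:~R * w.

Lemma eis_int (a : int) : eis a%:~R.
Proof. by exists a, 0; rewrite mul0r addr0. Qed.

Lemma eis0 : eis 0. Proof. exact: (eis_int 0). Qed.
Lemma eis1 : eis 1. Proof. exact: (eis_int 1). Qed.
Lemma eis_omega : eis w.
Proof. by exists 0, 1; rewrite add0r mul1r. Qed.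

Lemma eisD x y : eis x -> eis y -> eis (x + y).
Proof.
move=> [a [b ->]] [c [d ->]]; exists (a + c), (b + d).
by rewrite !rmorphD /=; ring.
Qed.

Lemma eisN x : eis x -> eis (- x).
Proof. by move=> [a [b ->]]; exists (- a), (- b); rewrite !rmorphN /=; ring. Qed.

Lemma eisB x y : eis x -> eis y -> eis (x - y).
Proof. by move=> ex ey; apply/eisD/eisN. Qed.

Lemma eisM x y : eis x -> eis y -> eis (x * y).
Proof.
move=> [a [b ->]] [c [d ->]]; exists (a * c - b * d), (a * d + b * c - b * d).
rewrite !(rmorphD, rmorphN, rmorphM) /=.
by ring: omega3_sqr.
Qed.

Lemma eis_conj x : eis x -> eis x^*.
Proof.
move=> [a [b ->]]; exists (a - b), (- b).
rewrite !conjE omega3_conj.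
by rewrite !(rmorphD, rmorphN) /=; ring.
Qed.

Lemma O3_eis z : O3 z <-> eis z.
Proof.
split=> [[p ->]|[a [b ->]]]; last first.
  exists (a%:P + b%:P * 'X).
  by rewrite rmorphD rmorphM /= !map_polyC map_polyX /= !hornerE.
elim/poly_ind: p => [|p c IHp]; first by rewrite rmorph0 horner0; exact: eis0.
rewrite rmorphD rmorphM /= map_polyX map_polyC /= !hornerE.
by apply: eisD (eis_int _); apply: eisM => //; exact: eis_omega.
Qed.

Lemma sqn_eis (a b : int) :
  sqn (a%:~R + b%:~R * w) = (a ^+ 2 - a * b + b ^+ 2)%:~R.
Proof.
apply: (@complexI R); rewrite sqnE !conjE omega3_conj.
rewrite !(rmorphD, rmorphN, rmorphM, rmorphXn) /= !rmorph_int.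
by ring: omega3_sqr.
Qed.

Lemma sqn_eis_nat z : eis z -> exists n : nat, sqn z = n%:R.
Proof.
move=> [a [b ez]]; exists `|(a ^+ 2 - a * b + b ^+ 2)%R|%N.
rewrite ez sqn_eis natr_absz ger0_norm //; nia.
Qed.

End Eisenstein.

(** * Heisenberg translations and developing *)

Section Vectors.
Variable R : realType.
Local Notation C := R[i].
Local Notation w := (omega3 R).

Definition vec : Type := (C * C * C)%type.

Definition vherm (u v : vec) : C :=
  u.1.1 * v.2^* + u.1.2 * v.1.2^* + u.2 * v.1.1^*.

Definition heis (t : C * C) (v : vec) : vec :=
  (v.1.1 - t.1^* * v.1.2 + t.2 * v.2, v.1.2 + t.1 * v.2, v.2).

Definition swap (v : vec) : vec := (v.2, - v.1.2, v.1.1).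

Definition scalev (c : C) (v : vec) : vec := (c * v.1.1, c * v.1.2, c * v.2).

Definition heis_pt (t : C * C) : Prop :=
  [/\ eis t.1, eis t.2 & t.2 + t.2^* = - (t.1 * t.1^*)].

Definition heis_mul (s t : C * C) : C * C :=
  (s.1 + t.1, s.2 + t.2 - s.1^* * t.1).

Definition heis_inv (t : C * C) : C * C := (- t.1, t.2^*).

Lemma heis_mulE s t v : heis (heis_mul s t) v = heis s (heis t v).
Proof.
rewrite /heis /heis_mul /= conjD.
by congr (_, _, _); ring.
Qed.

Lemma heis_pt_mul s t : heis_pt s -> heis_pt t -> heis_pt (heis_mul s t).
Proof.
move=> [es1 es2 hs] [et1 et2 ht]; rewrite /heis_mul; split=> /=.
- exact: eisD.
- by apply/eisB/eisM => //; [exact: eisD|exact: eis_conj].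
- rewrite !conjE.
  have -> : s.2 + t.2 - s.1^* * t.1 + (s.2^* + t.2^* - s.1 * t.1^*) =
    (s.2 + s.2^*) + (t.2 + t.2^*) - s.1^* * t.1 - s.1 * t.1^* by ring.
  by rewrite hs ht; ring.
Qed.

Lemma heis_pt_inv t : heis_pt t -> heis_pt (heis_inv t).
Proof.
move=> [e1 e2 h]; split=> /=; [exact: eisN|exact: eis_conj|].
by rewrite !conjE addrC h mulrNN.
Qed.

Lemma heis_mulV t : heis_pt t -> heis_mul t (heis_inv t) = (0, 0).
Proof.
move=> [_ _ h]; rewrite /heis_mul /heis_inv /= subrr; congr (_, _).
by rewrite h; ring.
Qed.

Lemma heis_mulVl t : heis_pt t -> heis_mul (heis_inv t) t = (0, 0).
Proof.
move=> [_ _ h]; rewrite /heis_mul /heis_inv /= addNr; congr (_, _).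
by rewrite conjE (addrC t.2^*) h; ring.
Qed.


Lemma heis0 v : heis (0, 0) v = v.
Proof.
case: v => [[a b] c]; rewrite /heis /= conj0.
by rewrite !mul0r subr0 !addr0.
Qed.

Lemma heisK t : heis_pt t -> cancel (heis t) (heis (heis_inv t)).
Proof. by move=> ht v; rewrite -heis_mulE heis_mulVl ?heis0. Qed.

Lemma heisVK t : heis_pt t -> cancel (heis (heis_inv t)) (heis t).
Proof. by move=> ht v; rewrite -heis_mulE heis_mulV ?heis0. Qed.

Lemma swapK : involutive swap.
Proof. by case=> [[a b] c]; rewrite /swap /= opprK. Qed.

Lemma scalev_heis c t v : scalev c (heis t v) = heis t (scalev c v).
Proof. by rewrite /scalev /heis /=; congr (_, _, _); ring. Qed.

Lemma scalev_swap c v : scalev c (swap v) = swap (scalev c v).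
Proof. by rewrite /scalev /swap /= mulrN. Qed.

Lemma vherm_heis t u v : heis_pt t -> vherm (heis t u) (heis t v) = vherm u v.
Proof.
move=> [_ _ h]; have {}h : t.2^* = - (t.1 * t.1^*) - t.2 by rewrite -h; ring.
by rewrite /vherm /heis /= !conjE h; ring.
Qed.

Lemma vherm_swap u v : vherm (swap u) (swap v) = vherm u v.
Proof. by rewrite /vherm /swap /= !conjE; ring. Qed.

Definition vec_eis (v : vec) : Prop := [/\ eis v.1.1, eis v.1.2 & eis v.2].

(* The properties of the first two columns of a matrix of U(2,1;O3) that are
   needed here; f itself need not be integral. *)
Definition frame (v f : vec) : Prop :=
  [/\ vec_eis v, v != 0, vherm v v = 0, vherm f v = 0 & vherm f f != 0].

Lemma heis_inj_pt t : heis_pt t -> injective (heis t).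
Proof. by move=> ht; apply: can_inj (heisK ht). Qed.

Lemma heis_v0 t : heis t 0 = 0.
Proof. by rewrite /heis /= !mulr0 subr0 !addr0. Qed.

Lemma swap_v0 : swap 0 = 0. Proof. by rewrite /swap /= oppr0. Qed.

Lemma vec_eis_heis t v : heis_pt t -> vec_eis v -> vec_eis (heis t v).
Proof.
move=> [et1 et2 _] [e1 e2 e3]; split => //=; last by apply/eisD/eisM.
by apply: eisD; [apply: eisB => //|]; apply: eisM => //; exact: eis_conj.
Qed.

Lemma vec_eis_swap v : vec_eis v -> vec_eis (swap v).
Proof. by move=> [e1 e2 e3]; split => //=; exact: eisN. Qed.

Lemma frame_heis t v f : heis_pt t -> frame v f -> frame (heis t v) (heis t f).
Proof.
move=> ht [ev v0 hv hf hff]; split; rewrite ?vherm_heis //.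
- exact: vec_eis_heis.
- by rewrite -(heis_v0 t) (inj_eq (heis_inj_pt ht)).
Qed.

Lemma frame_swap v f : frame v f -> frame (swap v) (swap f).
Proof.
move=> [ev v0 hv hf hff]; split; rewrite ?vherm_swap //.
- exact: vec_eis_swap.
- by rewrite -swap_v0 (inj_eq (can_inj swapK)).
Qed.

Lemma frame_bottom v f : frame v f -> v.2 = 0 ->
  exists a k u, [/\ v = (a, 0, 0), f = (k, u, 0) & u != 0].
Proof.
case: v => [[a b] c]; case: f => [[k u] l] [_ + + + +] /= c0.
rewrite {c}c0 /vherm /= !conj0 !mulr0 !mul0r !add0r !addr0 => v0 /eqP.
rewrite mulf_eq0 conjC_eq0 orbb => /eqP b0; move: v0; rewrite {b}b0.
rewrite conj0 mulr0 add0r => v0 /eqP; rewrite mulf_eq0 conjC_eq0.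
have -> : (a == 0) = false by apply: contra_neqF v0 => /eqP->.
rewrite orbF => /eqP->; rewrite conj0 mulr0 mul0r !addr0 add0r.
by rewrite mulf_eq0 conjC_eq0 orbb => u0; exists a, k, u.
Qed.

Definition height (v : vec) : R := sqn v.2.

Definition lowers t (v : vec) : Prop := sqn (heis t v).1.1 < height v.

(* [dev v f x]: the point 0 of the plane attached to the cusp of the frame
   (v, f) is developed to x in the plane attached to the cusp at infinity. *)
Inductive dev : vec -> vec -> C -> Prop :=
| dev_bottom a k u : u != 0 -> dev (a, 0, 0) (k, u, 0) (- (k / u)^*)
| dev_step t v f x : heis_pt t -> lowers t v ->
    dev (swap (heis t v)) (swap (heis t f)) x -> dev v f (x - t.1).

Lemma dev_step' t v f (x : C) : heis_pt t -> lowers t v ->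
  dev (swap (heis t v)) (swap (heis t f)) (x + t.1) -> dev v f x.
Proof. by move=> ht lt dx; rewrite -[x](addrK t.1); exact: dev_step dx. Qed.

Lemma scalevA c d v : scalev c (scalev d v) = scalev (c * d) v.
Proof. by rewrite /scalev /= !mulrA. Qed.

Lemma scale1v v : scalev 1 v = v.
Proof. by case: v => [[x y] z]; rewrite /scalev /= !mul1r. Qed.

(** Only the first step has to change: composing its translation with the inverse of t leads to the
    same vectors. *)
Lemma dev_heis t v f (x : C) : heis_pt t -> dev v f x ->
  dev (heis t v) (heis t f) (x + t.1).
Proof.
move=> ht; elim=> [a k u u0|s {}v {}f {}x hs lsv dx _].
  rewrite /heis /= !mulr0 subr0 !addr0.
  have -> : - (k / u)^* + t.1 = - ((k - t.1^* * u) / u)^*.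
    by rewrite mulrBl mulfK // !conjE; ring.
  exact: dev_bottom.
have hst := heis_pt_mul hs (heis_pt_inv ht).
have e u : heis (heis_mul s (heis_inv t)) (heis t u) = heis s u.
  by rewrite heis_mulE heisK.
apply: (dev_step' hst); first by rewrite /lowers e.
have -> : x - s.1 + t.1 + (heis_mul s (heis_inv t)).1 = x.
  by rewrite /=; ring.
by rewrite !e.
Qed.

Lemma dev_scale c v f (x : C) : eis c -> sqn c = 1 -> dev v f x ->
  dev (scalev c v) (scalev c f) x.
Proof.
move=> ec c1; have c0 := sqn1_neq0 c1.
elim=> [a k u u0|s {}v {}f {}x hs lsv _ IH].
  have -> : k / u = (c * k) / (c * u) by rewrite -mulf_div divff ?mul1r.
  by rewrite /scalev /= mulr0; apply: dev_bottom; rewrite mulf_neq0.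
apply: (dev_step hs); last by rewrite -!scalev_heis -!scalev_swap.
by rewrite /lowers -scalev_heis /height /= !sqnM c1 !mul1r.
Qed.

(** The integral translations at Cygan distance 1 from the identity: [q.2] has real part - 1/2 and
    modulus 1, so it is a primitive cube root of unity. *)
Definition adjacent (q : C * C) : Prop :=
  [/\ heis_pt q, sqn q.1 = 1 & q.2 = w \/ q.2 = w^*].

Lemma adjacent2 q : adjacent q ->
  [/\ q.2 * q.2 = - q.2 - 1, q.2^* = - q.2 - 1, eis q.2 & sqn q.2 = 1].
Proof.
have sw : sqn w = 1.
  by rewrite -[w]add0r -[w in 0 + w]mul1r -[1]/(1%:~R) -[0]/(0%:~R) sqn_eis.
move=> [[_ eq2 _] _ [] e]; rewrite e ?conjK; split=> //.
- exact: omega3_sqr.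
- exact: omega3_conj.
- exact: eis_omega.
- by rewrite omega3_conj; ring: (@omega3_sqr R).
- by rewrite omega3_conj; ring.
- by apply/eis_conj/eis_omega.
- by rewrite sqn_conj.
Qed.

(** This is the relation J T J = m T' J T'' with m = [q.2]. The two horizontal parts on the right
    add up to [q.1] because [q.2 + q.2^*] is -1. *)
Lemma swap_adjacent q v : adjacent q ->
  swap (heis q v) = scalev q.2 (heis (- q.1 * q.2^*, q.2^*)
    (swap (heis (- q.1 * q.2, q.2^*) (swap v)))).
Proof.
move=> hq; have [mm mc _ _] := adjacent2 hq; case: hq => _ /sqn1P n1 _.
case: v => [[x y] z]; rewrite /heis /swap /scalev /= !conjE !mc.
move: q.1 q.2 n1 mm {mc} => n m n1 mm.
congr (_, _, _).
- by ring: mm n1.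
- by ring: mm n1.
- by ring: mm n1.
Qed.

End Vectors.

(** * Coordinates on the Heisenberg group *)

Section Coordinates.
Variable R : realType.
Local Notation C := R[i].
Local Notation w := (omega3 R).
Local Notation vec := (vec R).
Local Notation rt3 := (Num.sqrt 3 : R).
Implicit Types (v f : vec) (t q : C * C) (A d e X y s : R).

(** Real coordinates fitting those of [cyg]; the real part of the second entry is what [heis_pt]
    prescribes. *)
Definition heis_coord A d e : C * C :=
  (Complex A (rt3 * d), Complex (- (A * A + 3 * d * d) / 2) (rt3 * e / 2)).

Lemma complex_eq (x y : C) : complex.Re x = complex.Re y ->
  complex.Im x = complex.Im y -> x = y.
Proof. by case: x => a b; case: y => c d /= -> ->. Qed.

Lemma hpt_mul A d e A' d' e' : heis_mul (heis_coord A d e) (heis_coord A' d' e') =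
  heis_coord (A + A') (d + d') (e + e' - 2 * (A * d' - A' * d)).
Proof.
have h3 := @sqrt3_sqr R; congr (_, _); apply: complex_eq => //=.
- by ring.
- by field: h3.
- by field: h3.
Qed.

Lemma sqn_hpt A d e : sqn (heis_coord A d e).1 = A * A + 3 * d * d.
Proof. by have h3 := @sqrt3_sqr R; rewrite /sqn /=; ring: h3. Qed.

(** The coordinates are read off v divided by its last entry; isotropy determines the real part of
    z1. *)
Lemma vec_coords v : v.2 != 0 -> vherm v v = 0 -> exists X y s,
  forall A d e, sqn (heis (heis_coord A d e) v).1.1 =
    height v * (cyg (X + A) (y + d) (s + e - 2 * (A * y - d * X)) / 4).
Proof.
have h3 := @sqrt3_sqr R.
have r0 : rt3 != 0 by apply: contra_eq_neq h3 => ->; rewrite mul0r eq_sym pnatr_eq0.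
move=> v2 vv; pose z1 := v.1.1 / v.2; pose z2 := v.1.2 / v.2.
exists (complex.Re z2), (complex.Im z2 / rt3), (2 * complex.Im z1 / rt3) => A d e.
have -> : (heis (heis_coord A d e) v).1.1 =
    v.2 * (z1 - (heis_coord A d e).1^* * z2 + (heis_coord A d e).2).
  by rewrite /= /z1 /z2; field.
rewrite sqnM; congr (_ * _).
have hz : complex.Re z1 = - (sqn z2) / 2.
  have v2c : v.2^* != 0 by rewrite conjC_eq0.
  have : z1 + z1^* = - (z2 * z2^*).
    have -> : z1 + z1^* = (v.1.1 * v.2^* + v.2 * v.1.1^*) / (v.2 * v.2^*).
      by rewrite /z1 conjM conjV; field; rewrite v2c.
    have -> : z2 * z2^* = v.1.2 * v.1.2^* / (v.2 * v.2^*).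
      by rewrite /z2 conjM conjV; field; rewrite v2c.
    rewrite -mulNr; congr (_ / _); apply/eqP; rewrite -addr_eq0 -vv /vherm.
    by apply/eqP; ring.
  rewrite -sqnE => /(congr1 (@complex.Re R)) /=.
  by case: (z1) => a b /=; lra.
move: hz; rewrite /sqn /cyg; case: z1 z2 => [a b] [X Y] /= ->.
have [y ->] : exists y, Y = rt3 * y by exists (Y / rt3); rewrite mulrC divfK.
have [s ->] : exists s, b = rt3 * s / 2.
  by exists (2 * b / rt3); field.
rewrite [rt3 * y]mulrC mulfK //.
have -> : 2 * (rt3 * s / 2) / rt3 = s by field.
by field: h3.
Qed.

(** Integrality makes the vertical coordinate congruent modulo 2 to the norm of a + b omega3; c is
    the remaining freedom. *)
Definition heis_lattice (a b c : int) : C * C :=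
  heis_coord (a%:~R - b%:~R / 2) (b%:~R / 2) (a ^+ 2 - a * b + b ^+ 2 + 2 * c)%:~R.

Lemma lptE a b c : heis_lattice a b c = (a%:~R + b%:~R * w,
  c%:~R + (a ^+ 2 - a * b + b ^+ 2 + 2 * c)%:~R * w).
Proof.
have cint (k : int) : k%:~R = Complex k%:~R 0 :> C by rewrite -(rmorph_int (real_complex R)).
rewrite /heis_lattice /heis_coord !cint /omega3; congr (_, _); apply: complex_eq => /=.
- by field.
- by field.
- by rewrite !(rmorphD, rmorphN, rmorphM, rmorphXn) /=; field.
- by rewrite !(rmorphD, rmorphN, rmorphM, rmorphXn) /=; field.
Qed.

Lemma lpt_heis a b c : heis_pt (heis_lattice a b c).
Proof.
rewrite lptE; split=> /=; [by exists a, b|by eexists _, _|].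
rewrite !conjE omega3_conj !(rmorphD, rmorphN, rmorphM, rmorphXn) /=.
by ring: (@omega3_sqr R).
Qed.

Lemma heis_lpt t : heis_pt t -> exists a b c, t = heis_lattice a b c.
Proof.
case: t => t1 t2 [/= [a [b ->]] [c [k ->]]] h; exists a, b, c; rewrite lptE.
congr (_, _); congr (_ + _%:~R * w).
have /(congr1 (@complex.Re R)) := h.
rewrite -sqnE sqn_eis.
have cint (l : int) : l%:~R = Complex l%:~R 0 :> C by rewrite -(rmorph_int (real_complex R)).
rewrite !cint /omega3 /= => h'.
have : (2 * c - k)%:~R = (- (a ^+ 2 - a * b + b ^+ 2))%:~R :> R.
  rewrite rmorphB rmorphN rmorphM /= -[X in _ = - X]/(complex.Re (Complex _ 0)) /=.
  by move: h'; rewrite /=; lra.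
by move/eqP; rewrite eqr_int => /eqP; lia.
Qed.

Lemma units6_adjacent A d e : (A, d) \in units6 R -> e = 1 \/ e = - 1 ->
  adjacent (heis_coord A d e).
Proof.
move=> Ad ee.
have n1 : A * A + 3 * d * d = 1.
  move: Ad; rewrite !inE !xpair_eqE.
  by case/or4P=> [g|g|g|/or3P[g|g|g]]; case/andP: g => /eqP-> /eqP->; field.
have [a [b [Aab dab]]] : exists a b : int, A = a%:~R - b%:~R / 2 /\ d = b%:~R / 2.
  have sol (a b : int) : A = a%:~R - b%:~R / 2 -> d = b%:~R / 2 ->
     exists a b : int, A = a%:~R - b%:~R / 2 /\ d = b%:~R / 2 by exists a, b.
  move: Ad; rewrite !inE !xpair_eqE.
  case/or4P=> [g|g|g|/or3P[g|g|g]]; case/andP: g => /eqP eA /eqP ed.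
  - by apply: (sol 1 0); rewrite ?eA ?ed; field.
  - by apply: (sol 1 1); rewrite ?eA ?ed; field.
  - by apply: (sol 0 1); rewrite ?eA ?ed; field.
  - by apply: (sol (- 1) 0); rewrite ?eA ?ed; field.
  - by apply: (sol (- 1) (- 1)); rewrite ?eA ?ed; field.
  - by apply: (sol 0 (- 1)); rewrite ?eA ?ed; field.
have N1 : a ^+ 2 - a * b + b ^+ 2 = 1.
  apply/eqP; rewrite -(eqr_int R); apply/eqP; apply: etrans n1; rewrite Aab dab.
  by rewrite !(rmorphD, rmorphN, rmorphM, rmorphXn) /=; field.
split; last 2 first.
- by rewrite sqn_hpt.
- rewrite /heis_coord /= n1; case: ee => ->; [left|right]; apply: complex_eq => /=; by field.
have [c ->] : exists c : int, e = (a ^+ 2 - a * b + b ^+ 2 + 2 * c)%:~R.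
  rewrite N1; case: ee => ->; [exists 0|exists (- 1)] => //.
by rewrite Aab dab; exact: lpt_heis.
Qed.

Lemma round_half (x : R) : exists k : int, - (1 / 2) <= x + k%:~R /\ x + k%:~R <= 1 / 2.
Proof.
exists (- Num.floor (x + 1 / 2)).
have := floor_itv (x + 1 / 2); rewrite rmorphN rmorphD /= => /andP[]; lra.
Qed.

(** Rounding leaves errors of at most 1/2, 1/4 and 1 in the three coordinates, so the Cygan norm is
    at most (1/4 + 3/16)^2 + 3, which is below 4. *)
Lemma heis_near v : vherm v v = 0 -> v.2 != 0 -> exists2 t, heis_pt t & lowers t v.
Proof.
move=> vv v2; have [X [y [s h]]] := vec_coords v2 vv.
(* The coordinates are rounded in the order b, a, c, since b shifts the real part and both shift the
   vertical coordinate. *)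
have [b [b1 b2]] := round_half (2 * y).
have [a [a1 a2]] := round_half (X - b%:~R / 2).
pose m := s + (a ^+ 2 - a * b + b ^+ 2)%:~R
  - 2 * ((a%:~R - b%:~R / 2) * y - (b%:~R / 2) * X).
have [c [c1 c2]] := round_half (m / 2).
exists (heis_lattice a b c); first exact: lpt_heis.
rewrite /lowers /heis_lattice h -[ltRHS]mulr1 ltr_pM2l ?sqn_gt0 //.
set p := X + _; set r := y + _; set g := s + _ - _.
have p1 : p * p <= 1 / 4 by rewrite /p; nra.
have r1 : r * r <= 1 / 16 by rewrite /r; nra.
have g1 : g * g <= 1.
  have -> : g = m + 2 * c%:~R by rewrite /g /m rmorphD rmorphM /=; ring.
  by nra.
clearbody p r g; clear - p1 r1 g1; rewrite /cyg.
have := sqr_ge0 p; have := sqr_ge0 r; have := sqr_ge0 g.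
set P := p * p in p1 *; set Q := r * r in r1 *.
move=> g0 r0 p0; have -> : p * p + 3 * r * r = P + 3 * Q by rewrite /P /Q; ring.
have P0 : 0 <= P by [].
have Q0 : 0 <= Q by [].
have h1 : (P + 3 * Q) ^+ 2 <= (1 / 2) ^+ 2 by rewrite lerXn2r ?nnegrE //; lra.
by clear - h1 g1; lra.
Qed.

(** In the coordinates of v the two height conditions read 2 <= [cyg] <= 4, the range of
    [has_lower_adjP]. *)
Lemma adjacent_descent v : v.2 != 0 -> vherm v v = 0 ->
  height v <= 2 * sqn v.1.1 -> sqn v.1.1 <= height v ->
  exists2 q, adjacent q & sqn (heis q v).1.1 < sqn v.1.1.
Proof.
move=> v2 vv; have [X [y [s h]]] := vec_coords v2 vv.
have h0 : 0 < height v by rewrite sqn_gt0.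
have e0 : sqn v.1.1 = height v * (cyg X y s / 4).
  rewrite -{1}(heis0 v); have -> : (0, 0) = heis_coord 0 0 0.
    by congr (_, _); apply: complex_eq => /=; rewrite ?mulr0 ?mul0r ?addr0 ?oppr0 ?mul0r.
  by rewrite h /cyg; congr (_ * (_ / _)); ring.
rewrite e0 mulrCA ler_pMr // => D1; rewrite ger_pMr // => D2.
have [||A [d [e [Ad ee lo]]]] := @has_lower_adjP _ X y s.
- by clear - D1; lra.
- by clear - D2; lra.
exists (heis_coord A d e); first exact: units6_adjacent.
by rewrite h ltr_pM2l // ltr_pM2r ?invr_gt0 ?ltr0n.
Qed.


Lemma eis_small (a b k : int) : a ^+ 2 - a * b + b ^+ 2 = k -> k < 6 ->
  [\/ a = - 2, a = - 1, a = 0 | a = 1 \/ a = 2] /\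
  [\/ b = - 2, b = - 1, b = 0 | b = 1 \/ b = 2].
Proof.
have bnd (x y : int) : x ^+ 2 - x * y + y ^+ 2 < 6 ->
    [\/ x = - 2, x = - 1, x = 0 | x = 1 \/ x = 2].
  move=> n6; have h1 : 3 * (x * x) < 24 by have := sqr_ge0 (2 * y - x); lia.
  have x1 : - 2 <= x by clear n6; nia.
  have x2 : x <= 2 by clear n6 x1; nia.
  have : (x = - 2 \/ x = - 1) \/ (x = 0 \/ (x = 1 \/ x = 2)) by clear h1 n6; lia.
  by case=> [[]|[]] ?; [apply: Or41|apply: Or42|apply: Or43|apply: Or44].
move=> <- n6; split; first exact: bnd n6.
by apply: (bnd b a); move: n6; congr (_ < _); ring.
Qed.

Lemma eis_norm_cases (a b : int) : a ^+ 2 - a * b + b ^+ 2 < 6 ->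
  let n := a ^+ 2 - a * b + b ^+ 2 in
  [\/ n = 0 /\ a = 0 /\ b = 0, n = 1, n = 3 | n = 4].
Proof.
move=> n6 n; move: (n6); have [] := eis_small erefl n6; rewrite {}/n.
by case=> [->|->|->|[]->]; case=> [->|->|->|[]->] // _;
  first [by apply: Or41|by apply: Or42|by apply: Or43|by apply: Or44].
Qed.

Ltac mem_units6 := rewrite !inE !xpair_eqE; apply/or4P; first
  [ by apply: Or41; apply/andP; split; apply/eqP; field
  | by apply: Or42; apply/andP; split; apply/eqP; field
  | by apply: Or43; apply/andP; split; apply/eqP; field
  | by apply/Or44/or3P/Or31; apply/andP; split; apply/eqP; field
  | by apply/Or44/or3P/Or32; apply/andP; split; apply/eqP; field
  | by apply/Or44/or3P/Or33; apply/andP; split; apply/eqP; field ].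

Lemma units6_norm1 (a b : int) : a ^+ 2 - a * b + b ^+ 2 = 1 ->
  (a%:~R - b%:~R / 2, b%:~R / 2) \in units6 R.
Proof.
move=> n1; have := n1; have [] := eis_small n1 isT.
case=> [->|->|->|[]->]; case=> [->|->|->|[]->] // _; mem_units6.
Qed.

Lemma units6_norm4 (a b : int) : a ^+ 2 - a * b + b ^+ 2 = 4 ->
  ((a%:~R - b%:~R / 2) / 2, b%:~R / 2 / 2) \in units6 R.
Proof.
move=> n1; have := n1; have [] := eis_small n1 isT.
case=> [->|->|->|[]->]; case=> [->|->|->|[]->] // _; mem_units6.
Qed.

Lemma units6_norm3 (a b : int) e : a ^+ 2 - a * b + b ^+ 2 = 3 ->
  e = 1 \/ e = - 1 ->
  ((a%:~R - b%:~R / 2) / 2 + b%:~R / 2 * e / 2,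
   b%:~R / 2 / 2 - (a%:~R - b%:~R / 2) * e / 6) \in units6 R.
Proof.
move=> n1 ee; have := n1; have [] := eis_small n1 isT.
by case=> [->|->|->|[]->]; case=> [->|->|->|[]->] // _; case: ee => ->; mem_units6.
Qed.

(** This is the connectivity of the good choices. Both Cygan norms are below 2, so [cyg_average]
    leaves only the norms 0, 1, 3 and 4 for the horizontal part of t; for 3 and 4 an intermediate
    point is needed. *)
Lemma small_pair v t : v.2 != 0 -> vherm v v = 0 -> heis_pt t ->
  2 * sqn v.1.1 < height v -> 2 * sqn (heis t v).1.1 < height v ->
  [\/ t = (0, 0), adjacent t |
    exists q r, [/\ adjacent q, adjacent r, t = heis_mul r q & lowers q v]].
Proof.
move=> v2 vv /heis_lpt[a [b [c ->]]]; have [X [y [s h]]] := vec_coords v2 vv.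
have h0 : 0 < height v by rewrite sqn_gt0.
have e00 : heis_coord 0 0 0 = (0, 0).
  by congr (_, _); apply: complex_eq => /=; rewrite ?mulr0 ?mul0r ?addr0 ?oppr0 ?mul0r.
have e0 : sqn v.1.1 = height v * (cyg X y s / 4).
  rewrite -{1}(heis0 v) -e00.
  by rewrite h /cyg; congr (_ * (_ / _)); ring.
rewrite e0 mulrCA gtr_pMr // => D1.
rewrite /heis_lattice h mulrCA gtr_pMr // => D2.
set A := a%:~R - _ in D2 *; set d := b%:~R / 2 in D2 *.
set n : int := a ^+ 2 - a * b + b ^+ 2 in D2 *.
set e : R := (n + 2 * c)%:~R in D2 *.
have nE : n%:~R = A * A + 3 * d * d.
  by rewrite /n /A /d !(rmorphD, rmorphN, rmorphM, rmorphXn) /=; field.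
have := cyg_average X y s A d e; rewrite -nE /=.
set x1 := X + A / 2; set y1 := y + d / 2; set s1 := s + e / 2 - _.
set J := A * y1 - d * x1; set P := A * x1 + 3 * d * y1.
set r := x1 * x1 + 3 * y1 * y1 => avg.
have r0 : 0 <= r by rewrite /r; nra.
have PJ : P ^+ 2 + 3 * J ^+ 2 = n%:~R * r.
  by rewrite nE /P /J /r; ring.
have H : (r + n%:~R / 4) ^+ 2 + P ^+ 2 + 3 * s1 ^+ 2 + 3 * (e / 2 - J) ^+ 2 < 2.
  by clear - avg D1 D2; lra.
have P0 := sqr_ge0 P; have s0 := sqr_ge0 s1; have J0 := sqr_ge0 (e / 2 - J).
have n0 : 0 <= n%:~R :> R by rewrite nE; nra.
have n6 : n < 6.
  by rewrite -(ltr_int R); apply: (average_norm r0 n0); clear - H P0 s0 J0; lra.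
have HJ : (r + n%:~R / 4) ^+ 2 + 3 * (e / 2 - J) ^+ 2 < 2.
  by clear - H P0 s0; lra.
have HJ' : (r + n%:~R / 4) ^+ 2 + 3 * ((- e) / 2 - (- J)) ^+ 2 < 2.
  have -> : (- e) / 2 - (- J) = - (e / 2 - J) by ring.
  by rewrite sqrrN.
have rJ : 3 * J ^+ 2 <= n%:~R * r by clear - PJ P0; lra.
have rJ' : 3 * (- J) ^+ 2 <= n%:~R * r by rewrite sqrrN.
have lowersE A' d' e' : lowers (heis_coord A' d' e') v <->
    cyg (X + A') (y + d') (s + e' - 2 * (A' * y - d' * X)) < 4.
  rewrite /lowers h gtr_pMr // ltr_pdivrMr ?mul1r //.
clear D1 D2 avg h h0 e0 vv v2.
(* The integer e has the parity of n, so a bound on its absolute value pins it down. *)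
have odd_e : odd `|n| -> e < 3 -> - e < 3 -> e = 1 \/ e = - 1.
  rewrite /e => n_odd; rewrite -rmorphN /= !(ltr_int _ _ 3) => e3 e3'.
  have : n + 2 * c = 1 \/ n + 2 * c = - 1.
    by clear - n_odd e3 e3'; clearbody n; lia.
  by case=> ->; [left|right].
have e_bound (B : R) : (0 <= e -> e < B) -> (0 <= - e -> - e < B) -> 0 < B ->
    e < B /\ - e < B.
  move=> h1 h2 B0; have [e_ge0|e_lt0] := lerP 0 e.
    by split; [exact: h1|lra].
  by split; [lra|apply: h2; lra].
have := eis_norm_cases n6; rewrite -/n => -[[n_0 [a0 b0]]|n_1|n_3|n_4].
- apply: Or31; have eE : e = (2 * c)%:~R by rewrite /e n_0 add0r.
  have e4 : e ^+ 2 < 4.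
    move: HJ rJ; rewrite n_0 !mul0r addr0 => HJ rJ; apply: average0 rJ _.
    by have := sqr_ge0 r; lra.
  have c0 : c = 0.
    move: e4; rewrite eE -rmorphXn /= (ltr_int _ _ 4) => e4.
    by clear - e4; nia.
  by rewrite eE /A /d a0 b0 c0 mul0r subr0.
- apply: Or32; apply: units6_adjacent; first exact: units6_norm1.
  rewrite n_1 in HJ HJ' rJ rJ' *; rewrite mul1r in rJ rJ'.
  have [] := e_bound 3 _ _ _ => //.
  + by move=> e_ge0; exact: average1 rJ e_ge0 HJ.
  + by move=> e_ge0; exact: average1 rJ' e_ge0 HJ'.
  + by apply: odd_e; rewrite n_1.
- apply: Or33; rewrite n_3 in HJ HJ' rJ rJ' H PJ nE.
  have ee : e = 1 \/ e = - 1.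
    have [] := e_bound 3 _ _ _ => //.
    + by move=> e_ge0; exact: average3 rJ e_ge0 HJ.
    + by move=> e_ge0; exact: average3 rJ' e_ge0 HJ'.
    + by apply: odd_e; rewrite n_3.
  have [g gg lo] := average3_lower ee PJ H.
  have ee' : - e = 1 \/ - e = - 1 by case: ee => ->; rewrite ?opprK; [right|left].
  have gg' : - g = 1 \/ - g = - 1 by case: gg => ->; rewrite ?opprK; [right|left].
  have hN : A * A = 3 - 3 * d * d.
    by have h3 : 3 = A * A + 3 * d * d := nE; clear - h3; lra.
  (* The horizontal part of norm 3 is the sum of two units, obtained from it by rotations of 30
     degrees and division by sqrt 3. The vertical parts g and - g cancel, and the cross term of the
     product supplies e. *)
  exists (heis_coord (A / 2 + d * e / 2) (d / 2 - A * e / 6) g).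
  exists (heis_coord (A / 2 - d * e / 2) (d / 2 + A * e / 6) (- g)); split.
  + by apply: units6_adjacent => //; exact: units6_norm3.
  + apply: units6_adjacent => //.
    have -> : (A / 2 - d * e / 2, d / 2 + A * e / 6) =
      (A / 2 + d * - e / 2, d / 2 - A * - e / 6) by congr (_, _); ring.
    exact: units6_norm3.
  + rewrite hpt_mul; congr heis_coord.
    * by field.
    * by field.
    * by case: ee => ->; field: hN.
  + apply/lowersE; move: lo; congr (_ < _); rewrite /cyg.
    by rewrite /s1 /J /P /r /x1 /y1; case: ee => ->; field: hN.
- apply: Or33; rewrite n_4 in HJ HJ' rJ rJ' H PJ nE.
  have e44 : 4%:~R / 4 = 1 :> R by rewrite -[4%:~R]/(4 : R) divff ?pnatr_eq0.
  rewrite e44 in HJ HJ' H.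
  have e_0 : e = 0.
    have [] := e_bound 2 _ _ _ => //.
    + by move=> e_ge0; exact: average4 rJ e_ge0 HJ.
    + by move=> e_ge0; exact: average4 rJ' e_ge0 HJ'.
    rewrite /e n_4 -rmorphN /= !(ltr_int _ _ 2) => e2 e2'.
    by have -> : c = - 2 by clear - e2 e2'; lia.
  have [g gg lo] : exists2 g, g = 1 \/ g = - 1 & r ^+ 2 + 3 * (s1 + g) ^+ 2 < 4.
    by apply: (@average4_lower _ r P s1 J) => //; rewrite -e_0.
  have gg' : - g = 1 \/ - g = - 1 by case: gg => ->; rewrite ?opprK; [right|left].
  (* A horizontal part of norm 4 is twice a unit; here the cross term vanishes, in accordance with e
     = 0. *)
  exists (heis_coord (A / 2) (d / 2) g), (heis_coord (A / 2) (d / 2) (- g)); split.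
  + by apply: units6_adjacent => //; exact: units6_norm4.
  + by apply: units6_adjacent => //; exact: units6_norm4.
  + by rewrite hpt_mul e_0; congr heis_coord; field.
  + apply/lowersE; move: lo; congr (_ < _); rewrite /cyg.
    by rewrite /s1 /r /x1 /y1 e_0; field.
Qed.

End Coordinates.

(** * Independence of the choices *)

Section Uniqueness.
Variable R : realType.
Local Notation C := R[i].
Local Notation vec := (vec R).
Implicit Types (v f : vec) (t q : C * C) (x y : C).

Lemma sqn_eis_lt a b (n : nat) :
  eis a -> eis b -> sqn a < sqn b -> sqn b < n.+1%:R -> sqn a < n%:R :> R.
Proof.
move=> /sqn_eis_nat[k ->] /sqn_eis_nat[l ->]; rewrite !ltr_nat => kl ln.
exact: leq_trans kl ln.
Qed.

Lemma height_ind (P : vec -> vec -> Prop) :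
  (forall n v f, (forall v' f', frame v' f' -> height v' < n%:R -> P v' f') ->
    frame v f -> height v < n.+1%:R -> P v f) ->
  forall v f, frame v f -> P v f.
Proof.
move=> h v f vf; have [[_ _ /sqn_eis_nat[n hn]] _ _ _ _] := vf.
have : height v < n.+1%:R by rewrite /height hn ltr_nat.
elim: n.+1 {hn} v f vf => [v f _|m IHm v f vf hv].
  by rewrite ltNge sqn_ge0.
exact: (h m).
Qed.

Lemma frame_coord v f : frame v f -> eis v.1.1 /\ eis v.2.
Proof. by case=> [[]]. Qed.

Lemma dev_total v f : frame v f -> exists x, dev v f x.
Proof.
move: v f; apply: height_ind => n v f IH vf hv.
have [v2|v2] := eqVneq v.2 0.
  have [a [k [u [-> -> u0]]]] := frame_bottom vf v2.
  by exists (- (k / u)^*); exact: dev_bottom.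
have [_ _ vv _ _] := vf; have [t ht lt] := heis_near vv v2.
have tf := frame_heis ht vf.
have [|x dx] := IH _ _ (frame_swap tf); last by exists (x - t.1); apply: dev_step dx.
have [e1 _] := frame_coord tf; have [_ e2] := frame_coord vf.
exact: sqn_eis_lt lt hv.
Qed.

Lemma dev_inv v f x : dev v f x ->
  (exists a k u, [/\ u != 0, v = (a, 0, 0), f = (k, u, 0) & x = - (k / u)^*]) \/
  exists t y, [/\ heis_pt t, lowers t v,
    dev (swap (heis t v)) (swap (heis t f)) y & x = y - t.1].
Proof.
by case=> [a k u u0|t {}v {}f {}x ht lt d]; [left; exists a, k, u|right; exists t, x].
Qed.

Lemma lowers_neq0 t v : lowers t v -> v.2 != 0.
Proof. by rewrite -sqn_gt0; apply/le_lt_trans/sqn_ge0. Qed.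

Lemma sqn_heis_swap_adj q v : adjacent q ->
  sqn (heis (- q.1 * q.2, q.2^*) (swap v)).1.1 = sqn (heis q v).1.1.
Proof.
move=> hq; have [_ _ _ m1] := adjacent2 hq.
have := congr1 (fun u : vec => sqn u.2) (swap_adjacent v hq).
by rewrite /= sqnM m1 mul1r.
Qed.

Lemma adjacent_l q : adjacent q -> heis_pt (- q.1 * q.2, q.2^*).
Proof.
move=> hq; have [mm mc em m1] := adjacent2 hq; case: hq => [[en _ _] /sqn1P n1 _].
split; rewrite /= ?mc ?conjE ?mc.
- by apply/eisM => //; exact: eisN.
- by rewrite -mc; exact: eis_conj.
- by ring: mm n1.
Qed.

Lemma adjacent_r q : adjacent q -> heis_pt (- q.1 * q.2^*, q.2^*).
Proof.
move=> hq; have [mm mc em m1] := adjacent2 hq; case: hq => [[en _ _] /sqn1P n1 _].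
split; rewrite /= ?mc ?conjE ?mc.
- by rewrite -mc; apply/eisM; [exact: eisN|exact: eis_conj].
- by rewrite -mc; exact: eis_conj.
- by ring: mm n1.
Qed.

Definition dev_via v f t x : Prop := [/\ heis_pt t, lowers t v &
  dev (swap (heis t v)) (swap (heis t f)) (x + t.1)].

(** This and [dev_swap_below] are proved by a joint induction: uniqueness at n + 1 uses both at n,
    and swap invariance at n + 1 uses uniqueness at n + 1. Swapping exchanges the outer entries, so
    [dev_swap_below] bounds both. *)
Definition dev_uniq_below (n : nat) : Prop := forall v f x y,
  frame v f -> height v < n%:R -> dev v f x -> dev v f y -> x = y.

Definition dev_swap_below (n : nat) : Prop := forall v f x,
  frame v f -> height v < n%:R -> sqn v.1.1 < n%:R ->
  dev v f x -> dev (swap v) (swap f) x.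

Section Step.
Variables (n : nat).
Hypotheses (uniqn : dev_uniq_below n) (swapn : dev_swap_below n).
Variables (v f : vec).
Hypotheses (vf : frame v f) (hv : height v < n.+1%:R).

Lemma lowers_below t : heis_pt t -> lowers t v -> sqn (heis t v).1.1 < n%:R.
Proof.
move=> ht lt; have [e1 _] := frame_coord (frame_heis ht vf).
by have [_ e2] := frame_coord vf; exact: sqn_eis_lt lt hv.
Qed.

Lemma dev_via_uniq t x y : dev_via v f t x -> dev_via v f t y -> x = y.
Proof.
move=> [ht lt dx] [_ _ dy]; apply: (addIr t.1).
by apply: uniqn dx dy; [exact/frame_swap/frame_heis|exact: lowers_below].
Qed.

(** By [swap_adjacent] the new path differs from the old one by translations, a unit and one extra
    swap. That swap is covered by [swapn], since t and the product both lower v. *)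
Lemma dev_via_adjacent t q x : adjacent q -> dev_via v f t x ->
  lowers (heis_mul q t) v -> dev_via v f (heis_mul q t) x.
Proof.
move=> hq [ht lt dx] lqt; have [hq0 _ _] := hq.
have hqt := heis_pt_mul hq0 ht.
have hl := adjacent_l hq; have hr := adjacent_r hq.
have [_ mc em m1] := adjacent2 hq.
have tf := frame_swap (frame_heis ht vf).
split=> //; rewrite !heis_mulE !(swap_adjacent _ hq).
have -> : x + (heis_mul q t).1 = x + t.1 - q.1 * q.2 - q.1 * q.2^*.
  by rewrite mc /=; ring.
rewrite -!mulNr; apply/dev_scale/dev_heis => //; apply: swapn; last exact: dev_heis.
- exact: frame_heis.
- exact: lowers_below.
- rewrite sqn_heis_swap_adj // -heis_mulE; exact: lowers_below.
Qed.

(** While the new height is at least half the old one, [adjacent_descent] decreases it; this stops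
    because norms are natural numbers. *)
Lemma dev_via_minimal t x : dev_via v f t x ->
  exists2 s, dev_via v f s x & 2 * sqn (heis s v).1.1 < height v.
Proof.
move=> dt; have [ht lt _] := dt.
have [e1 _] := frame_coord (frame_heis ht vf).
have [k hk] := sqn_eis_nat e1.
elim/ltn_ind: k t {ht lt e1} hk dt => k IHk t hk dt.
have [ht lt _] := dt.
have [|hmin] := ltP (2 * sqn (heis t v).1.1) (height v); first by exists t.
have tf := frame_heis ht vf.
have [||||q hq lq] := @adjacent_descent R (heis t v) => //=.
- exact: lowers_neq0 lt.
- by case: tf.
- exact: ltW.
have {}lq : sqn (heis (heis_mul q t) v).1.1 < k%:R by rewrite heis_mulE -hk.
have [hq0 _ _] := hq.
have [e1 _] := frame_coord (frame_heis (heis_pt_mul hq0 ht) vf).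
have [l hl] := sqn_eis_nat e1.
apply: (IHk l _ (heis_mul q t)) => //; first by move: lq; rewrite hl ltr_nat.
apply: dev_via_adjacent => //.
by apply: lt_trans lt; rewrite hk.
Qed.

(** Both choices are first made minimal; by [small_pair] they are then at most two adjacent moves
    apart, through choices that still lower v. *)
Lemma dev_via_indep s t x y : dev_via v f s x -> dev_via v f t y -> x = y.
Proof.
move=> /dev_via_minimal[{}s ds ms] /dev_via_minimal[{}t dt mt].
have [hs ls _] := ds; have [ht lt _] := dt.
have sf := frame_heis hs vf.
pose r := heis_mul t (heis_inv s).
have hr : heis_pt r by apply/heis_pt_mul/heis_pt_inv.
have et : t = heis_mul r s.
  rewrite /r /heis_mul /=; case: hs => _ _ h; case: (t) => t1 t2 /=.
  have {}h : s.2^* = - (s.1 * s.1^*) - s.2 by rewrite -h; ring.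
  by rewrite conjD !conjE h; congr (_, _); ring.
have [|||||r0|rA|[q [p [hq hp er lq]]]] := @small_pair R (heis s v) r => //.
- exact: lowers_neq0 ls.
- by case: sf.
- by rewrite -heis_mulE -et.
- have e : t = s by rewrite et r0 /heis_mul /= !conj0 mul0r subr0 !add0r -surjective_pairing.
  by apply: dev_via_uniq ds _; rewrite -e.
- apply: dev_via_uniq dt; rewrite et; apply: dev_via_adjacent => //.
  by rewrite -et.
- have e : t = heis_mul p (heis_mul q s).
    rewrite et er /heis_mul /= conjD.
    by congr (_, _); ring.
  apply: dev_via_uniq dt; rewrite e; apply: dev_via_adjacent => //; last by rewrite -e.
  by apply: dev_via_adjacent => //; rewrite /lowers heis_mulE.
Qed.

Lemma dev_uniq_step x y : dev v f x -> dev v f y -> x = y.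
Proof.
move=> /dev_inv[[a [k [u [u0 ev ef ->]]]]|[s [x' [hs ls dx ->]]]] /dev_inv[].
- move=> [a' [k' [u' [_ _ ef' ->]]]].
  by move: ef'; rewrite ef => -[-> ->].
- by move=> [t [? [_ /lowers_neq0]]]; rewrite ev eqxx.
- by move=> [a [? [? [_ ev]]]]; move: (lowers_neq0 ls); rewrite ev eqxx.
- move=> [t [y' [ht lt dy ->]]].
  by apply: (@dev_via_indep s t); split; rewrite ?subrK.
Qed.

End Step.

Lemma heis_pt0 : heis_pt (0, 0 : C).
Proof.
by split; rewrite /= ?conj0 ?mulr0 ?addr0 ?oppr0 //; exact: eis0.
Qed.

(** If the outer entries differ in norm, one of v and [swap v] develops to the other by a step with
    trivial translation. If they agree, an adjacent q lowers v, and [swap_adjacent] converts the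
    step by q for v into one for [swap v]. *)
Lemma dev_swap_step n : dev_uniq_below n.+1 -> dev_swap_below n.+1.
Proof.
move=> uniqn v f x vf h2 h1 dx; have fs := frame_swap vf.
have [_ v0 vv _ _] := vf.
have direct (u g : vec) (z : C) : sqn u.1.1 < height u -> dev (swap u) (swap g) z -> dev u g z.
  move=> lu dz; apply: (dev_step' heis_pt0); first by rewrite /lowers heis0.
  by rewrite !heis0 addr0.
case: (ltgtP (sqn v.1.1) (height v)) => h12.
- have [y dy] := dev_total fs.
  by rewrite (uniqn _ _ _ _ vf h2 dx (direct _ _ _ h12 dy)).
- by apply: direct => //; rewrite !swapK.
have v2 : v.2 != 0.
  apply: contraNneq v0 => v2.
  have [a [k [u [ev _ _]]]] := frame_bottom vf v2.
  move: h12; rewrite /height v2 ev /= => /eqP.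
  by rewrite {2}/sqn /= expr0n addr0 sqn_eq0 => /eqP->.
have [||||q hq] := @adjacent_descent R v => //.
- by rewrite h12 ler_peMl ?sqn_ge0 ?ler1n.
- by rewrite h12.
rewrite h12 => lq; have [hq0 _ _] := hq.
have [y dy] := dev_total (frame_swap (frame_heis hq0 vf)).
have := uniqn _ _ _ _ vf h2 dx (dev_step hq0 lq dy); set z := y - _ => xz.
have hl := adjacent_l hq; have hr := adjacent_r hq.
have [_ mc em m1] := adjacent2 hq.
apply: (dev_step' hl).
  by rewrite /lowers sqn_heis_swap_adj // /height /= h12.
have n1 : sqn q.2^* = 1 by rewrite sqn_conj.
have cm : q.2^* * q.2 = 1 by rewrite mulrC sqn1P.
(* Strip off the unit, then the outer translation. *)
move: dy; rewrite !(swap_adjacent _ hq) => /(dev_scale (eis_conj em) n1).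
rewrite !scalevA cm !scale1v => /(dev_heis (heis_pt_inv hr)).
rewrite !heisK //; congr (dev _ _ _).
by rewrite xz /z /= mc; ring.
Qed.

Lemma dev_below n : dev_uniq_below n /\ dev_swap_below n.
Proof.
elim: n => [|n [uniqn swapn]].
  by split=> [v f x y|v f x] _; rewrite ltNge sqn_ge0.
have uniqn' : dev_uniq_below n.+1.
  by move=> v f x y vf hv; exact: dev_uniq_step uniqn swapn _ _ vf hv x y.
by split=> //; exact: dev_swap_step.
Qed.

Lemma nat_above (r : R) : exists n : nat, r < n%:R.
Proof. by exists (Num.truncn r).+1; exact: truncnS_gt. Qed.

Theorem dev_uniq v f x y : frame v f -> dev v f x -> dev v f y -> x = y.
Proof.
move=> vf; have [n hn] := nat_above (height v).
by have [uniqn _] := dev_below n; exact: uniqn.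
Qed.

Theorem dev_swap v f x : frame v f -> dev v f x -> dev (swap v) (swap f) x.
Proof.
move=> vf; have [n] := nat_above (height v + sqn v.1.1).
have h1 := sqn_ge0 v.2; have h2 := sqn_ge0 v.1.1; rewrite /height => hn.
have [_ swapn] := dev_below n; apply: swapn => //.
  by apply: le_lt_trans hn; rewrite lerDl.
by apply: le_lt_trans hn; rewrite lerDr.
Qed.

End Uniqueness.

(** * The index computations *)

Section Groups.
Local Open Scope group_scope.
Variable G : groupType.
Implicit Types (H K : set G) (x y : G).

(** The cosets of the powers of x are pairwise distinct. *)
Lemma infinite_index_powers H K x : subgroup_set H ->
  (forall k, K (x ^+ k)) -> (forall k, (0 < k)%N -> ~ H (x ^+ k)) ->
  infinite_index H K.
Proof.
move=> [H1 _ HV] Kx Hx fin.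
pose g k := left_coset (x ^+ k) H.
have inj k l : (k < l)%N -> g k <> g l.
  move=> kl e; apply: (Hx (l - k)%N); first by rewrite subn_gt0.
  have : g l (x ^+ l) by exists 1; rewrite ?mulg1.
  rewrite -e => -[h Hh hx]; suff -> : x ^+ (l - k) = h by [].
  by apply: (mulgI (x ^+ k)); rewrite hx -expgnDr subnKC // ltnW.
apply: infinite_nat; have -> : [set: nat] = g @^-1` [set left_coset y H | y in K].
  by apply/seteqP; split=> k //= _; exists (x ^+ k).
apply: finite_preimage => // k l _ _ e.
by case: (ltngtP k l) => // /inj; rewrite e.
Qed.

Lemma derived_subgroup_sub K : subgroup_set K -> derived_subgroup K `<=` K.
Proof.
move=> sK; apply: smallest_sub => // z [x Kx [y Ky <-]].
case: sK => _ KM KV.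
exact: (KM _ _ (KM _ _ (KM _ _ Kx Ky) (KV _ Kx)) (KV _ Ky)).
Qed.

Lemma subgroup_derived K : subgroup_set (derived_subgroup K).
Proof.
split=> [L [[]] //|x y xK yK L sL|x xK L sL].
  by case: (sL) => [[_ LM _] _]; apply: LM; [exact: xK|exact: yK].
by case: (sL) => [[_ _ LV] _]; apply: LV; exact: xK.
Qed.

Lemma normal_derived K : subgroup_set K -> normal_subgroup (derived_subgroup K) K.
Proof.
move=> sK; have dK := derived_subgroup_sub sK.
split=> // [|x y Kx dy]; first exact: subgroup_derived.
have -> : x * y * x^-1 = grp_comm x y * y by rewrite /grp_comm mulgVK.
have [_ DM _] := subgroup_derived K; apply: DM => // L [_ LK]; apply: LK.
by exists x => //; exists y => //; exact: dK.
Qed.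

End Groups.

Lemma subgroup_range (G H : groupType) (f : UMagmaMorphism.type G H) :
  subgroup_set (range f).
Proof.
split=> [|_ _ [x _ <-] [y _ <-]|_ [x _ <-]].
- by exists 1%g => //; rewrite gmulf1.
- by exists (x * y)%g => //; rewrite gmulfM.
- by exists (x^-1)%g => //; rewrite gmulfV.
Qed.

(** * Exponent sums and evaluation of words *)

Definition exponent_sum (I : choiceType) (u : word I) : int :=
  \sum_(l <- u) (if l.2 then -1 else 1).

Lemma exponent_sum_cat (I : choiceType) (u v : word I) :
  exponent_sum (u ++ v) = exponent_sum u + exponent_sum v.
Proof. exact: big_cat. Qed.

Lemma exponent_sum_inv (I : choiceType) (u : word I) :
  exponent_sum (winv u) = - exponent_sum u.
Proof.
elim: u => [|[i b] u IHu]; first by rewrite /exponent_sum big_nil oppr0.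
rewrite -cat1s winv_cat !exponent_sum_cat IHu opprD addrC; congr (_ + _).
by rewrite /exponent_sum !big_seq1; case: b.
Qed.

Lemma exponent_sum_comm (I : choiceType) (u v : word I) :
  exponent_sum (wcomm u v) = 0.
Proof. by rewrite /wcomm !exponent_sum_cat !exponent_sum_inv; lia. Qed.

Lemma weval_morph (I : choiceType) (G H : groupType) (f : UMagmaMorphism.type G H)
    (g : I -> G) (u : word I) : f (weval g u) = weval (f \o g) u.
Proof.
rewrite /weval; elim: u => [|l u IHu]; first by rewrite !big_nil gmulf1.
by rewrite !big_cons gmulfM IHu; case: l.2 => //=; rewrite gmulfV.
Qed.

(** * Matrices acting on columns, and the development of words *)

Section Matrices.
Variable R : realType.
Local Notation C := R[i].
Local Notation w := (omega3 R).
Local Notation vec := (vec R).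
Implicit Types (M : GL C 3) (F : vec -> vec) (t : C * C) (u v : vec).

Definition colv p (j : 'I_p) (M : 'M[C]_(3, p)) : vec := (M 0 j, M 1 j, M 2 j).

Lemma sum3 (F : 'I_3 -> C) : \sum_i F i = F 0 + F 1 + F 2.
Proof.
rewrite !big_ord_recl big_ord0 addr0 addrA.
by congr (_ + F _ + F _); exact: val_inj.
Qed.

Lemma ord3P (P : 'I_3 -> Prop) : P 0 -> P 1 -> P 2 -> forall i, P i.
Proof.
move=> P0 P1 P2 [[|[|[|//]]] lti].
- by have -> : Ordinal lti = 0 by exact: val_inj.
- by have -> : Ordinal lti = 1 by exact: val_inj.
- by have -> : Ordinal lti = 2 by exact: val_inj.
Qed.

Lemma colv_mx3 (a b c d e f g h i : C) p (N : 'M[C]_(3, p)) j :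
  colv j (mx3 [:: [:: a; b; c]; [:: d; e; f]; [:: g; h; i]] *m N) =
  let x := colv j N in
  (a * x.1.1 + b * x.1.2 + c * x.2, d * x.1.1 + e * x.1.2 + f * x.2,
   g * x.1.1 + h * x.1.2 + i * x.2).
Proof. by rewrite /colv !mxE !sum3 !mxE. Qed.

Lemma colv_scale p (j : 'I_p) c (N : 'M[C]_(3, p)) :
  colv j (c *: N) = scalev c (colv j N).
Proof. by rewrite /colv !mxE. Qed.

(** Allowing any number of columns covers products, the identity matrix and single vectors alike. *)
Definition acts_by M F : Prop :=
  forall p (N : 'M[C]_(3, p)) j, colv j (M *m N) = F (colv j N).

Lemma acts_by_mul M M' F F' : acts_by M F -> acts_by M' F' ->
  acts_by (M * M')%g (F \o F').
Proof. by move=> aM aM' p N j; rewrite -mulmxA aM aM'. Qed.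

Lemma acts_by_inv M F F' : acts_by M F -> cancel F F' -> acts_by (M^-1)%g F'.
Proof.
move=> aM FK p N j.
have e : N = M *m (invmx M *m N) by rewrite mulmxA (mulmxV (Defs.GL_unit M)) mul1mx.
by rewrite [in RHS]e aM FK.
Qed.


Lemma O3_colv (M : 'M[C]_3) :
  (forall j, vec_eis (colv j M)) -> forall i j, O3 (M i j).
Proof.
move=> h i j; apply/O3_eis; have [h0 h1 h2] := h j.
by move: i; apply: ord3P.
Qed.

Lemma U21_acts M F : acts_by M F -> (forall u v, vherm (F u) (F v) = vherm u v) ->
  U21 M.
Proof.
move=> aM hF Z W.
have hermE (X Y : 'cV[C]_3) : herm X Y = vherm (colv 0 X) (colv 0 Y) by [].
by rewrite !hermE !aM hF.
Qed.

Definition eis_isometry F : Prop :=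
  (forall u v, vherm (F u) (F v) = vherm u v) /\
  (forall v, vec_eis v -> vec_eis (F v)).

Lemma eis_isometry_comp F F' :
  eis_isometry F -> eis_isometry F' -> eis_isometry (F \o F').
Proof.
move=> [h1 e1] [h2 e2]; split=> [u v|v ev]; first by rewrite /= h1 h2.
by apply/e1/e2.
Qed.

Lemma eis_isometry_heis t : heis_pt t -> eis_isometry (heis t).
Proof. by move=> ht; split=> [u v|v]; [exact: vherm_heis|exact: vec_eis_heis]. Qed.

Lemma eis_isometry_swap : eis_isometry (@swap R).
Proof. by split=> [u v|v]; [exact: vherm_swap|exact: vec_eis_swap]. Qed.

Lemma colv_id : [/\ colv 0 (1%:M : 'M[C]_3) = (1, 0, 0),
  colv 1 (1%:M : 'M[C]_3) = (0, 1, 0) & colv 2 (1%:M : 'M[C]_3) = (0, 0, 1)].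
Proof. by rewrite /colv !mxE. Qed.

Lemma colv_acts M F j : acts_by M F -> colv j M = F (colv j (1%:M : 'M[C]_3)).
Proof. by move=> aM; rewrite -aM mulmx1. Qed.

Lemma PU21_O3_acts M F : acts_by M F -> eis_isometry F -> PU21_O3 (PGL_class M).
Proof.
move=> aM [hF eF]; have UM := U21_acts aM hF.
split; first by exists M.
exists M; split=> //; apply: O3_colv => j; rewrite (colv_acts j aM).
apply: eF; have [e0 e1 e2] := colv_id; move: j; apply: ord3P.
all: by rewrite ?e0 ?e1 ?e2; split; (exact: eis1 || exact: eis0).
Qed.

(** Horizontal translation by -1; its matrix is [rho1_mx1]. *)
Definition horo1 : C * C := (-1, w^*).
(** Horizontal translation by omega3; its powers will witness the second infinite index. *)
Definition horo2 : C * C := (w, w).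

Lemma horo1_pt : heis_pt horo1.
Proof.
split=> /=; [exact/eisN/eis1|exact/eis_conj/eis_omega|].
by rewrite !conjE omega3_conj; ring.
Qed.

Lemma horo2_pt : heis_pt horo2.
Proof.
split=> /=; [exact/eis_omega|exact/eis_omega|].
by rewrite omega3_conj; ring: (@omega3_sqr R).
Qed.

Definition heis_mx t : 'M[C]_3 :=
  mx3 [:: [:: 1; - t.1^*; t.2]; [:: 0; 1; t.1]; [:: 0; 0; 1]].

Lemma heis_mxE t p (N : 'M[C]_(3, p)) j : colv j (heis_mx t *m N) = heis t (colv j N).
Proof. by rewrite colv_mx3 /heis /=; congr (_, _, _); ring. Qed.

Lemma colv_inj p (M N : 'M[C]_(3, p)) : (forall j, colv j M = colv j N) -> M = N.
Proof.
move=> h; apply/matrixP => i j; have [e0 e1 e2] := h j.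
by move: i; apply: ord3P.
Qed.

Lemma heis_mx_inv t : heis_pt t -> heis_mx t *m heis_mx (heis_inv t) = 1%:M.
Proof.
move=> ht; rewrite -[LHS]mulmx1; apply: colv_inj => j.
by rewrite -mulmxA !heis_mxE heisVK.
Qed.

Definition heis_GL t (ht : heis_pt t) : GL C 3 :=
  MkGL (mulmx1_unit (heis_mx_inv ht)).1.

Lemma heis_GL_acts t (ht : heis_pt t) : acts_by (heis_GL ht) (heis t).
Proof. by move=> p N j; exact: heis_mxE. Qed.

Definition rho1_GL (b : bool) : GL C 3 := if b then rho1_GL1 R else rho1_GL3 R.

Definition rho1_act (b : bool) : vec -> vec :=
  if b then heis horo1 else @swap R \o (heis horo1 \o @swap R).

Definition rho1_actV (b : bool) : vec -> vec :=
  if b then heis (heis_inv horo1) else @swap R \o (heis (heis_inv horo1) \o @swap R).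

Lemma rho1_actK b : cancel (rho1_act b) (rho1_actV b).
Proof.
case: b => v /=; first exact/heisK/horo1_pt.
by rewrite swapK heisK ?swapK //; exact: horo1_pt.
Qed.

Lemma rho1_GL_acts b : acts_by (rho1_GL b) (rho1_act b).
Proof.
have ea : Complex (- 2^-1) (- (Num.sqrt 3 / 2)) = w^* by [].
move=> p N j; case: b; rewrite /= ?/rho1_mx1 ?/rho1_mx3 ea colv_mx3 /heis /swap /=.
  by rewrite !conjE; congr (_, _, _); ring.
by rewrite !conjE; congr (_, _, _); ring.
Qed.

Lemma rho1_gens_class b : PGL_class (rho1_GL b) = rho1_gens R b.
Proof. by case: b. Qed.

Definition letter_act (l : bool * bool) : vec -> vec :=
  if l.2 then rho1_actV l.1 else rho1_act l.1.

Lemma letter_isometry l : eis_isometry (letter_act l).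
Proof.
have h1 := eis_isometry_heis horo1_pt.
have h2 := eis_isometry_heis (heis_pt_inv horo1_pt).
have hs := eis_isometry_swap.
by case: l => -[] [] //; do !apply: eis_isometry_comp.
Qed.

Fixpoint word_act (u : word bool) : vec -> vec :=
  if u is l :: u' then letter_act l \o word_act u' else id.

Lemma word_isometry (u : word bool) : eis_isometry (word_act u).
Proof. by elim: u => [|l u IHu] //=; apply/eis_isometry_comp/IHu/letter_isometry. Qed.

Lemma word_acts (u : word bool) : acts_by (weval rho1_GL u) (word_act u).
Proof.
elim: u => [|l u IHu]; first by move=> p N j; rewrite /weval big_nil mul1mx.
rewrite /weval big_cons; apply: acts_by_mul IHu.
by rewrite /letter_act; case: l.2; [apply/acts_by_inv/rho1_actK|]; exact: rho1_GL_acts.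
Qed.

Lemma letter_dev l v f (x : C) : frame v f -> dev v f x ->
  frame (letter_act l v) (letter_act l f) /\
  dev (letter_act l v) (letter_act l f) (x - (if l.2 then -1 else 1)).
Proof.
have hp := horo1_pt; have hV := heis_pt_inv hp.
move=> vf dx; have sf := frame_swap vf; have ds := dev_swap vf dx.
case: l => -[] [] /=; rewrite ?opprK.
- by split; [exact: frame_heis|have := dev_heis hV dx; rewrite /= opprK].
- by split; [exact: frame_heis|exact: (dev_heis hp dx)].
- split; first exact/frame_swap/frame_heis.
  by apply: dev_swap; [exact: frame_heis|have := dev_heis hV ds; rewrite /= opprK].
- split; first exact/frame_swap/frame_heis.
  by apply: dev_swap; [exact: frame_heis|exact: (dev_heis hp ds)].
Qed.

(** Each letter translates the developed point by -1 or 1, possibly between two swaps, which do not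
    move it by [dev_swap]. *)
Lemma word_dev (u : word bool) : frame (word_act u (1, 0, 0)) (word_act u (0, 1, 0)) /\
  dev (word_act u (1, 0, 0)) (word_act u (0, 1, 0)) (- (exponent_sum u)%:~R).
Proof.
elim: u => [|l u [vf dx]].
  rewrite /exponent_sum big_nil /=; split; last first.
    have -> : - 0%:~R = - (0 / 1)^* :> C by rewrite mul0r conj0.
    by apply: dev_bottom; exact: oner_neq0.
  split; rewrite /vherm /= ?conj0 ?conj1 ?(mulr0, mul0r, mulr1, addr0, add0r) ?oner_neq0 //.
    by split; (exact: eis1 || exact: eis0).
  by apply/eqP => -[] /eqP; rewrite oner_eq0.
have [vf' dx'] := letter_dev l vf dx; split=> //.
have -> : - (exponent_sum (l :: u))%:~R =
    - (exponent_sum u)%:~R - (if l.2 then -1 else 1) :> C.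
  rewrite /exponent_sum big_cons rmorphD opprD addrC; congr (_ - _).
  by case: l.2.
exact: dx'.
Qed.

(** A matrix fixing the cusp at infinity also develops without any step; [dev_uniq] compares the
    result with [word_dev]. *)
Lemma word_bottom (u : word bool) (a k b : C) : b != 0 ->
  colv 0 (weval rho1_GL u) = (a, 0, 0) -> colv 1 (weval rho1_GL u) = (k, b, 0) ->
  (exponent_sum u)%:~R = (k / b)^*.
Proof.
move=> b0; have [e0 e1 _] := colv_id.
rewrite !(colv_acts _ (word_acts u)) e0 e1 => c0 c1.
have [vf dx] := word_dev u; rewrite c0 c1 in vf dx.
by apply: oppr_inj; apply: dev_uniq vf dx _; exact: dev_bottom.
Qed.


(** * Exponent sums on the image of the representation *)

Lemma weval_rho1 (u : word bool) :
  PGL_class (weval rho1_GL u) = weval (@rho1_gens R) u.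
Proof.
rewrite (weval_morph (@PGL_class C 3)); congr weval.
by apply/funext => b; exact: rho1_gens_class.
Qed.

Lemma range_rho1 x : range (@rho1 R) x <-> exists u : word bool, x = weval (@rho1_gens R) u.
Proof.
split=> [[g _ <-]|[u ->]]; first by exists (repr g).
by exists (pres_class fig8_rels u) => //; exact: pres_liftE.
Qed.

(** The quotient of the two words evaluates to a scalar matrix, which develops 0 to 0. Hence the
    exponent sum is well defined on the image of [rho1]. *)
Lemma weval_rho1_exponent (u v : word bool) :
  weval (@rho1_gens R) u = weval (@rho1_gens R) v ->
  exponent_sum u = exponent_sum v.
Proof.
move=> uv; apply/eqP; rewrite -subr_eq0 -exponent_sum_inv -exponent_sum_cat.
have : PGL_class (weval rho1_GL (u ++ winv v)) = PGL_class 1%g.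
  by rewrite weval_rho1 weval_cat weval_inv uv mulgV gmulf1.
move=> /PGL_classP[c c0 e].
have [e0 e1 _] := colv_id.
have := @word_bottom (u ++ winv v) c 0 c c0; rewrite e !colv_scale e0 e1.
rewrite /scalev /= mulr0 mulr1 mul0r conj0 => /(_ erefl erefl) /eqP.
by rewrite intr_eq0.
Qed.

Lemma derived_rho1 x : derived_subgroup (range (@rho1 R)) x ->
  exists2 u : word bool, x = weval (@rho1_gens R) u & exponent_sum u = 0.
Proof.
move: x; apply: smallest_sub.
  split=> [|_ _ [u -> u0] [v -> v0]|_ [u -> u0]].
  - by exists [::]; rewrite /weval /exponent_sum ?big_nil.
  - by exists (u ++ v); rewrite ?weval_cat // exponent_sum_cat u0 v0.
  - by exists (winv u); rewrite ?weval_inv // exponent_sum_inv u0.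
move=> _ [_ /range_rho1[u ->] [_ /range_rho1[v ->] <-]].
by exists (wcomm u v); rewrite ?weval_grp_comm ?exponent_sum_comm.
Qed.

Lemma weval_nseq k : weval (@rho1_gens R) (nseq k (true, false)) =
  (rho1_gens R true ^+ k)%g.
Proof.
rewrite /weval; elim: k => [|k IHk]; first by rewrite big_nil expg0.
by rewrite big_cons IHk expgS.
Qed.

Lemma exponent_sum_nseq k : exponent_sum (nseq k (true, false)) = k :> int.
Proof.
rewrite /exponent_sum; elim: k => [|k IHk]; first by rewrite big_nil.
by rewrite big_cons IHk /=; lia.
Qed.

Lemma acts_by_expg M F k : acts_by M F -> acts_by (M ^+ k)%g (iter k F).
Proof.
move=> aM; elim: k => [|k IHk]; first by move=> p N j; rewrite expg0 mul1mx.
by rewrite expgS; apply: acts_by_mul IHk.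
Qed.

Lemma eis_isometry_iter F k : eis_isometry F -> eis_isometry (iter k F).
Proof. by move=> hF; elim: k => [|k IHk] //; exact: (eis_isometry_comp hF IHk). Qed.

Lemma iter_heis_e1 t k : iter k (heis t) (1, 0, 0) = (1, 0, 0).
Proof. by elim: k => //= k ->; rewrite /heis /= !mulr0 subr0 !addr0. Qed.

Lemma iter_heis_e2 t k : iter k (heis t) (0, 1, 0) = (- (k%:R * t.1^*), 1, 0).
Proof.
elim: k => [|k IHk]; first by rewrite /= mul0r oppr0.
by rewrite iterS IHk /heis /= !mulr0 mulr1 !addr0 -natr1; congr (_, _, _); ring.
Qed.

Lemma horo2_not_rho1 k : (0 < k)%N ->
  ~ range (@rho1 R) (PGL_class (heis_GL horo2_pt) ^+ k)%g.
Proof.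
move=> k0 /range_rho1[u]; rewrite -weval_rho1 -gmulfXn => /esym /PGL_classP[c c0 e].
have [e0 e1 _] := colv_id.
have a2 := acts_by_expg k (heis_GL_acts horo2_pt).
have := @word_bottom u c (c * - (k%:R * w^*)) c c0.
rewrite e !colv_scale !(colv_acts _ a2) e0 e1 iter_heis_e1 iter_heis_e2.
rewrite /scalev /= !mulr0 !mulr1 => /(_ erefl erefl).
have -> : c * - (k%:R * w^*) / c = - (k%:Z%:~R * w^*) by field.
rewrite !conjE => /eqP; rewrite -subr_eq0 opprK => /eqP h.
(* An integer plus k omega3 vanishes, whereas the norm form is definite and k > 0. *)
have : sqn ((exponent_sum u)%:~R + k%:Z%:~R * w) = 0 by rewrite h /sqn /= expr0n addr0.
rewrite sqn_eis => /eqP; rewrite intr_eq0 => /eqP.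
by nia.
Qed.

End Matrices.

Theorem proposition4p1 (R : realType) :
  [/\ normal_subgroup (derived_subgroup (range (@rho1 R))) (range (@rho1 R)),
      range (@rho1 R) `<=` @PU21_O3 R,
      infinite_index (derived_subgroup (range (@rho1 R))) (range (@rho1 R)) &
      infinite_index (range (@rho1 R)) (@PU21_O3 R)].
Proof.
have sK : subgroup_set (range (@rho1 R)) := subgroup_range (@rho1 R).
split.
- exact: normal_derived.
- move=> x /range_rho1[u ->]; rewrite -weval_rho1.
  by apply: (PU21_O3_acts (@word_acts R u)); exact: word_isometry.
(* The k-th power of the image of g1 has exponent sum k, and elements of the derived subgroup have
   exponent sum 0. *)
- apply: (@infinite_index_powers _ _ _ (rho1_gens R true)).
  + exact: subgroup_derived.
  + by move=> k; apply/range_rho1; exists (nseq k (true, false)); rewrite weval_nseq.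
  + move=> k k0 /derived_rho1[u]; rewrite -weval_nseq => /weval_rho1_exponent.
    by rewrite exponent_sum_nseq => <- [] k_0; rewrite k_0 in k0.
- apply: (@infinite_index_powers _ _ _ (PGL_class (heis_GL (horo2_pt R)))) => //.
  + move=> k; rewrite -gmulfXn; apply: PU21_O3_acts (acts_by_expg k (@heis_GL_acts _ _ _)) _.
    by apply: eis_isometry_iter; apply: eis_isometry_heis; exact: horo2_pt.
  + exact: horo2_not_rho1.
Qed.
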